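(* Every balanced generalized basilica group is either (locally finite)-by-(virtually abelian) or not elementary amenable.
   Context: Let $X$ be a finite set with $|X|\ge 2$, let $X^*$ be the free monoid on $X$, viewed as a rooted tree (its Cayley graph), and let $\mathrm{Aut}(X^* )$ be the group of bijections $g$ of $X^*$ such that $a$ is a prefix of $b$ if and only if $g(a)$ is a prefix of $g(b)$. For $g\in\mathrm{Aut}(X^* )$ and $w\in X^*$, the section $g_w\in \mathrm{Aut}(X^* )$ is the automorphism determined by $g(wu)=g(w)g_w(u)$ for all $u\in X^*$. A group $G\le\mathrm{Aut}(X^* )$ is a generalized basilica group if it admits a finite generating set $Y$ (called a distinguished generating set; one writes $G=\langle Y\rangle\leq \mathrm{Aut}(X^* )$) such that for every $g\in Y$ either $g_x=1$ for all $x\in X$, or $g_x\in\{1,g\}$ for all $x\in X$ with exactly one $x\in X$ such that $g_x=g$. A generalized basilica group $G=\langle Y\rangle\le\mathrm{Aut}(X^* )$ is balanced if for each $g\in Y$ such that there is $x\in X$ for which $g_x=g$, the least $n\ge 1$ for which $g^n$ fixes $x$ is also such that $g^n$ fixes $X$ pointwise. A group is $A$-by-$B$ if it has a normal subgroup with property $A$ whose quotient has property $B$. The class of elementary amenable groups is the smallest class of groups containing all finite groups and all abelian groups and closed under taking subgroups, quotients, group extensions, and direct limits. *)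

(* Defs.v *)
(* Groups are the (possibly infinite) groupTypes of mathcomp.boot.monoid;      *)
(* subgroups are its groupClosed predicates, boolean-valued by classical logic. *)
From HB Require Import structures.
From mathcomp Require Import all_boot.
From mathcomp Require Import boolp classical_sets cardinality.

Set Implicit Arguments.
Unset Strict Implicit.
Unset Printing Implicit Defensive.

Local Open Scope group_scope.
Local Open Scope quotient_scope.
Local Open Scope classical_set_scope.

Section Subgroup.
Variables (G : groupType) (H : groupClosed G).

Record subgroup := Subgroup {
  subgroup_val :> G;
  subgroup_mem : subgroup_val \in H
}.

HB.instance Definition _ := [isSub for subgroup_val].
HB.instance Definition _ := [Choice of subgroup by <:].

Lemma subgroup_closed : group_closed (fun x : G => x \in H).
Proof. by split=> [|x y xH yH]; [exact: gpred1 | exact: (@gpredF G H)]. Qed.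

HB.instance Definition _ :=
  SubChoice_isSubGroup.Build G (fun x : G => x \in H) subgroup
    subgroup_closed.
End Subgroup.

Definition generated (G : groupType) (Y : set G) : {pred G} :=
  fun x => `[< forall H : groupClosed G,
                 (forall y, Y y -> y \in H) -> x \in H >].

Section GeneratedGroup.
Variables (G : groupType) (Y : set G).

Lemma generated1 : 1 \in generated Y.
Proof. by apply/asboolP => H _; exact: gpred1. Qed.

Lemma generatedM : mulg_closed (generated Y).
Proof.
move=> x y /asboolP xY /asboolP yY; apply/asboolP => H YH.
by apply: gpredM; [exact: xY | exact: yY].
Qed.

Lemma generatedV : invg_closed (generated Y).
Proof.
by move=> x /asboolP xY; apply/asboolP => H YH; apply: gpredVr; exact: xY.
Qed.

HB.instance Definition _ := isMulClosed.Build G (generated Y) generatedM.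
HB.instance Definition _ := isMul1Closed.Build G (generated Y) generated1.
HB.instance Definition _ := isInvClosed.Build G (generated Y) generatedV.
End GeneratedGroup.

Record normalSubgroup (G : groupType) := NormalSubgroup {
  normal_subgroup :> groupClosed G;
  normal_conj : forall x g : G,
    x \in normal_subgroup -> x ^ g \in normal_subgroup
}.

Section Quotient.
Variables (G : groupType) (N : normalSubgroup G).

Definition eqmod_coset : rel G := fun x y => x^-1 * y \in N.

Lemma eqmod_coset_refl : reflexive eqmod_coset.
Proof. by move=> x; rewrite /eqmod_coset mulVg gpred1. Qed.

Lemma eqmod_coset_sym : symmetric eqmod_coset.
Proof.
by move=> x y; rewrite /eqmod_coset -[LHS]gpredV invgM invgK.
Qed.

Lemma eqmod_coset_trans : transitive eqmod_coset.
Proof.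
move=> y x z xy yz; rewrite /eqmod_coset -(mulgK y x^-1) -mulgA.
exact: gpredM.
Qed.

Canonical eqmod_coset_equiv :=
  EquivRel eqmod_coset eqmod_coset_refl eqmod_coset_sym eqmod_coset_trans.

Definition quotient : Type := {eq_quot eqmod_coset}.

HB.instance Definition _ := Choice.on quotient.
HB.instance Definition _ := EqQuotient.on quotient.

Definition quotient_one : quotient := \pi_quotient 1%g.
Definition quotient_mul (a b : quotient) : quotient := \pi_quotient (repr a * repr b)%g.
Definition quotient_inv (a : quotient) : quotient := \pi_quotient ((repr a)^-1)%g.

Lemma eqmod_coset_repr x : eqmod_coset (repr (\pi_quotient x)) x.
Proof. by apply/(@eqquotP _ _ quotient); rewrite reprK. Qed.

Lemma pi_quotientM x y :
  quotient_mul (\pi_quotient x) (\pi_quotient y) = \pi_quotient (x * y)%g.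
Proof.
apply/(@eqquotP _ _ quotient); rewrite /= /eqmod_coset.
set x' := repr _; set y' := repr _.
have -> : (x' * y')^-1 * (x * y) = (x'^-1 * x) ^ y' * (y'^-1 * y).
  by rewrite /conjg invgM !mulgA mulgK.
apply: gpredM; last exact: eqmod_coset_repr.
by apply: normal_conj; exact: eqmod_coset_repr.
Qed.

Lemma pi_quotientV x : quotient_inv (\pi_quotient x) = \pi_quotient (x^-1)%g.
Proof.
apply/(@eqquotP _ _ quotient); rewrite /= /eqmod_coset.
set x' := repr _.
have -> : x'^-1^-1 * x^-1 = ((x'^-1 * x)^-1) ^ x'^-1.
  by rewrite /conjg invgM !invgK !mulgA mulgK.
by apply: normal_conj; rewrite gpredV; exact: eqmod_coset_repr.
Qed.

Lemma quotient_mulA : associative quotient_mul.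
Proof.
move=> a b c; rewrite -[a]reprK -[b]reprK -[c]reprK.
rewrite (pi_quotientM (repr b) (repr c)) (pi_quotientM (repr a) (repr b)).
by rewrite !pi_quotientM mulgA.
Qed.

Lemma quotient_mul1 : left_id quotient_one quotient_mul.
Proof. by move=> a; rewrite -[a]reprK pi_quotientM mul1g. Qed.

Lemma quotient_mulr1 : right_id quotient_one quotient_mul.
Proof. by move=> a; rewrite -[a]reprK pi_quotientM mulg1. Qed.

Lemma quotient_mulV : left_inverse quotient_one quotient_inv quotient_mul.
Proof. by move=> a; rewrite -[a]reprK pi_quotientV pi_quotientM mulVg. Qed.

Lemma quotient_mulrV : right_inverse quotient_one quotient_inv quotient_mul.
Proof. by move=> a; rewrite -[a]reprK pi_quotientV pi_quotientM mulgV. Qed.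

HB.instance Definition _ := isGroup.Build quotient
  quotient_mulA quotient_mul1 quotient_mulr1 quotient_mulV quotient_mulrV.
End Quotient.

Definition finite_group (G : groupType) : Prop := finite_set [set: G].

Definition abelian_group (G : groupType) : Prop :=
  forall x y : G, commute x y.

Definition locally_finite (G : groupType) : Prop :=
  forall A : set G, finite_set A -> finite_group (subgroup (generated A)).

Definition left_coset (G : groupType) (H : groupClosed G) (g : G) : set G :=
  [set g * h | h in [set h | h \in H]].

Definition finite_index (G : groupType) (H : groupClosed G) : Prop :=
  finite_set [set left_coset H g | g in [set: G]].

Definition virtually_abelian (G : groupType) : Prop :=
  exists H : groupClosed G, finite_index H /\ abelian_group (subgroup H).

Definition group_by (A B : groupType -> Prop) (G : groupType) : Prop :=
  exists N : normalSubgroup G, A (subgroup N) /\ B (quotient N).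

Record directedSystem := DirectedSystem {
  ds_index : Type;
  ds_le : ds_index -> ds_index -> Prop;
  ds_le_refl : forall i, ds_le i i;
  ds_le_trans : forall i j k, ds_le i j -> ds_le j k -> ds_le i k;
  ds_inhabited : inhabited ds_index;
  ds_directed : forall i j, exists k, ds_le i k /\ ds_le j k;
  ds_group : ds_index -> groupType;
  ds_map : forall i j, ds_le i j -> {multiplicative ds_group i -> ds_group j};
  ds_map_id : forall i (le_ii : ds_le i i) x, ds_map le_ii x = x;
  ds_map_comp : forall i j k
    (le_ij : ds_le i j) (le_jk : ds_le j k) (le_ik : ds_le i k) x,
    ds_map le_jk (ds_map le_ij x) = ds_map le_ik x
}.

(* L, with the maps iota i, is the disjoint union of the groups of the system *)
(* modulo the relation identifying two elements that have the same image in   *)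
(* some later group; direct_limit_universal below checks that this has the     *)
(* universal property of the colimit.                                          *)
Definition is_direct_limit (S : directedSystem) (L : groupType)
    (iota : forall i, {multiplicative @ds_group S i -> L}) : Prop :=
  (forall z : L, exists i x, iota i x = z) /\
  (forall i j (x : ds_group i) (y : ds_group j),
     iota i x = iota j y <->
     exists k (le_ik : ds_le i k) (le_jk : ds_le j k),
       ds_map le_ik x = ds_map le_jk y).

Lemma direct_limit_universal (S : directedSystem) (L : groupType)
    (iota : forall i, {multiplicative @ds_group S i -> L}) :
  is_direct_limit iota ->
  (forall i j (le_ij : @ds_le S i j) x, iota j (ds_map le_ij x) = iota i x) /\
  (forall (M : groupType) (f : forall i, {multiplicative @ds_group S i -> M}),
     (forall i j (le_ij : @ds_le S i j) x, f j (ds_map le_ij x) = f i x) ->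
     exists! u : L -> M,
       {morph u : x y / x * y} /\ forall i x, u (iota i x) = f i x).
Proof.
move=> [surj eqL].
have iotaE i j (le_ij : @ds_le S i j) x : iota j (ds_map le_ij x) = iota i x.
  apply/eqL; exists j, (ds_le_refl j), le_ij; exact: ds_map_id.
split=> // M f fE.
have rep z : exists v : M, exists i x, iota i x = z /\ v = f i x.
  by have [i [x xz]] := surj z; exists (f i x), i, x.
have [u uP] := choice rep.
have uE i x : u (iota i x) = f i x.
  have [j [y [/eqL[k [jk [ik yx]]] ->]]] := uP (iota i x).
  by rewrite -(fE _ _ jk) yx fE.
exists u; split; last first.
  move=> v [_ vE]; apply/funext => z.
  by have [i [x <-]] := surj z; rewrite uE vE.
split=> // x y; have [i [a <-]] := surj x; have [j [b <-]] := surj y.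
have [k [ik jk]] := ds_directed i j.
by rewrite -(iotaE _ _ ik) -(iotaE _ _ jk) -gmulfM !uE gmulfM.
Qed.

Inductive elementary_amenable : groupType -> Prop :=
| ea_finite (G : groupType) : finite_group G -> elementary_amenable G
| ea_abelian (G : groupType) : abelian_group G -> elementary_amenable G
| ea_isomorphic (G H : groupType) (f : {multiplicative G -> H}) :
    bijective f -> elementary_amenable G -> elementary_amenable H
| ea_subgroup (G : groupType) (H : groupClosed G) :
    elementary_amenable G -> elementary_amenable (subgroup H)
| ea_quotient (G : groupType) (N : normalSubgroup G) :
    elementary_amenable G -> elementary_amenable (quotient N)
| ea_extension (G : groupType) (N : normalSubgroup G) :
    elementary_amenable (subgroup N) -> elementary_amenable (quotient N) ->
    elementary_amenable G
| ea_direct_limit (S : directedSystem) (L : groupType)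
    (iota : forall i, {multiplicative @ds_group S i -> L}) :
    (forall i : ds_index S, elementary_amenable (ds_group i)) ->
    is_direct_limit iota -> elementary_amenable L.

Section TreeAut.
Variable X : finType.

(* The vertices of the rooted tree X^* are the words over X. *)
Definition is_tree_aut (g : seq X -> seq X) : Prop :=
  bijective g /\ forall a b : seq X, prefix a b <-> prefix (g a) (g b).

Record tree_aut := TreeAut {
  tree_aut_fun :> seq X -> seq X;
  tree_aut_proof : `[< is_tree_aut tree_aut_fun >]
}.

HB.instance Definition _ := [isSub for tree_aut_fun].
HB.instance Definition _ := [Choice of tree_aut by <:].

Implicit Types g h : tree_aut.

Lemma tree_autP g : is_tree_aut g.
Proof. exact/asboolP/tree_aut_proof. Qed.

Lemma tree_aut_eq g h : g =1 h -> g = h.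
Proof. by move=> gh; apply/val_inj/funext. Qed.

Lemma tree_aut_prefix g a b : prefix (g a) (g b) = prefix a b.
Proof. by apply/idP/idP; case: (tree_autP g) => _ /(_ a b) []. Qed.

Lemma is_tree_aut_id : is_tree_aut id.
Proof. by split=> //; exists id. Qed.

Definition tree_aut_one : tree_aut := TreeAut (asboolT is_tree_aut_id).

Lemma is_tree_aut_comp g h : is_tree_aut (g \o h).
Proof.
split; first exact: bij_comp (tree_autP g).1 (tree_autP h).1.
by move=> a b /=; rewrite !tree_aut_prefix.
Qed.

Definition tree_aut_mul g h : tree_aut :=
  TreeAut (asboolT (is_tree_aut_comp g h)).

Lemma tree_aut_inv_exists g :
  {h : seq X -> seq X | cancel g h /\ cancel h g}.
Proof. by apply/cid; case: (tree_autP g) => -[h gK hK] _; exists h. Qed.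

Lemma is_tree_aut_inv g : is_tree_aut (sval (tree_aut_inv_exists g)).
Proof.
case: (tree_aut_inv_exists g) => h [gK hK] /=; split; first by exists g.
by move=> a b; rewrite -(tree_aut_prefix g (h a)) !hK.
Qed.

Definition tree_aut_inv g : tree_aut := TreeAut (asboolT (is_tree_aut_inv g)).

Lemma tree_aut_mulA : associative tree_aut_mul.
Proof. by move=> f g h; exact: tree_aut_eq. Qed.

Lemma tree_aut_mul1 : left_id tree_aut_one tree_aut_mul.
Proof. by move=> g; exact: tree_aut_eq. Qed.

Lemma tree_aut_mulr1 : right_id tree_aut_one tree_aut_mul.
Proof. by move=> g; exact: tree_aut_eq. Qed.

Lemma tree_aut_mulV : left_inverse tree_aut_one tree_aut_inv tree_aut_mul.
Proof.
by move=> g; apply: tree_aut_eq => a /=; case: (tree_aut_inv_exists g) => h [].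
Qed.

Lemma tree_aut_mulrV : right_inverse tree_aut_one tree_aut_inv tree_aut_mul.
Proof.
by move=> g; apply: tree_aut_eq => a /=; case: (tree_aut_inv_exists g) => h [].
Qed.

(* (g * h) w = g (h w): automorphisms act on words from the left. *)
HB.instance Definition _ := isGroup.Build tree_aut
  tree_aut_mulA tree_aut_mul1 tree_aut_mulr1 tree_aut_mulV tree_aut_mulrV.

Definition section_fun g (w : seq X) : seq X -> seq X :=
  fun u => drop (size (g w)) (g (w ++ u)).

Lemma section_funE g w u : g (w ++ u) = g w ++ section_fun g w u.
Proof.
have : prefix (g w) (g (w ++ u)) by rewrite tree_aut_prefix prefix_prefix.
by case/prefixP=> v gwu; rewrite /section_fun gwu drop_size_cat.
Qed.

Lemma is_tree_aut_section g w : is_tree_aut (section_fun g w).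
Proof.
have [[h gK hK] _] := tree_autP g.
have pre a b : prefix (section_fun g w a) (section_fun g w b) = prefix a b.
  have := tree_aut_prefix g (w ++ a) (w ++ b).
  by rewrite !section_funE !prefix_catr // !eqxx.
split; last by move=> a b; rewrite pre.
exists (fun v => drop (size w) (h (g w ++ v))) => u.
  by rewrite -section_funE gK drop_size_cat.
have : prefix w (h (g w ++ u)).
  by rewrite -(tree_aut_prefix g) hK prefix_prefix.
case/prefixP=> v hv; rewrite hv drop_size_cat //.
by rewrite /section_fun -hv hK drop_size_cat.
Qed.

Definition section g w : tree_aut := TreeAut (asboolT (is_tree_aut_section g w)).

Lemma sectionP g w h :
  h = section g w <-> forall u, g (w ++ u) = g w ++ h u.
Proof.
split=> [-> u|gE]; first exact: section_funE.
by apply: tree_aut_eq => u; rewrite /= /section_fun gE drop_size_cat.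
Qed.

Definition basilica_generator g : Prop :=
  (forall x : X, section g [:: x] = 1) \/
  ((forall x : X, section g [:: x] = 1 \/ section g [:: x] = g) /\
   exists! x : X, section g [:: x] = g).

Definition distinguished_generating_set
    (G : groupClosed tree_aut) (Y : set tree_aut) : Prop :=
  [/\ finite_set Y, (forall g, g \in G <-> g \in generated Y) &
      forall g, Y g -> basilica_generator g].

Definition generalized_basilica (G : groupClosed tree_aut) : Prop :=
  exists Y : set tree_aut, distinguished_generating_set G Y.

Definition least_fixing_power g (x : X) (n : nat) : Prop :=
  [/\ (1 <= n)%N, (g ^+ n) [:: x] = [:: x] &
      forall m, (1 <= m)%N -> (g ^+ m) [:: x] = [:: x] -> (n <= m)%N].

Definition balanced_generating_set (Y : set tree_aut) : Prop :=
  forall g, Y g -> forall x : X, section g [:: x] = g ->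
  forall n, least_fixing_power g x n ->
  forall y : X, (g ^+ n) [:: y] = [:: y].

Definition balanced_generalized_basilica (G : groupClosed tree_aut) : Prop :=
  exists Y : set tree_aut,
    distinguished_generating_set G Y /\ balanced_generating_set Y.

End TreeAut.

(* Main.v *)
From HB Require Import structures.
Require Import Defs.
From mathcomp Require Import all_boot.
From mathcomp Require Import ssralg ssrint ssrnum intdiv zify.
From mathcomp Require Import boolp classical_sets cardinality.

(** Why the theorem is true.

    A generator [g] that is not determined by its action on letters has a unique
    active letter [x], where its section is [g] itself, while its other sections
    are trivial.  If [n] is the period of [x], balance says that [g ^+ n] fixes all
    letters, and its section is [g] along the orbit of [x] and trivial elsewhere.
    Sections at a letter [o] involve only generators whose active letter lies in
    the orbit [Om] of [o].  The property of having a finite-index subgroup with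
    locally finite derived subgroup passes from the section groups to the group
    (virtually_of_sections), so induction on the number of generators reduces to
    a group [H] for which all active letters lie in a single orbit [Om].

    There the active edges can be bypassed: for any two letters [z], [z'] of [Om],
    some element of [H] with trivial section at [z] carries [z] to [z']
    (linked_orbit), and every element of [H] is the section at [z] of an element
    fixing all letters (section_onto).  If [H] is elementary amenable, it is
    obtained from trivial groups by extensions with finite or cyclic quotients and
    directed unions (elementary_amenable_chou).  Call a subgroup large if its
    sections at some vertex contain a finite-index subgroup of [H].  The group [H]
    is large and trivial groups are not, so largeness is lost at some step of the
    construction; this step is not a finite extension, nor, by Schreier's lemma,
    a directed union.  So it is an extension by a
    homomorphism to the integers whose kernel is not large, and non-largeness
    forces the homomorphism to be determined by sections.  It therefore descends
    to a nonzero homomorphism [mu] on a normal finite-index subgroup [M] of [H]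
    that vanishes on the elements fixing some letter [z] of [Om] with trivial
    section at [z] (large_cyclic).

    Let [R] be the subgroup generated by all elements of [H] that fix some letter
    of [Om] with trivial section there.  They centralize [M] modulo the kernel of
    [mu], and a transfer argument shows that [mu] vanishes on the intersection of
    [R] and [M] (transfer_vanishing, mu_vanishes).  Hence some generator [g] must
    cycle through all of [Om] (exists_full_cycle), and modulo [R] every generator
    is the power of [g] that moves a letter in the same way, for every letter but
    its active one.  As [g] has infinite order modulo [R], the exponent does not
    depend on the letter; such a constant shift of a cycle with one exceptional
    letter is the rotation by [g] or by its inverse (rotation_rigidity).  So each
    generator acts on the words over [Om] as [g] or as its inverse, [H] acts on
    these words as an abelian group, and the elements acting trivially on them
    form a locally finite group, being a subgroup of a power of a finite group
    (locfin_ker). *)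

Set Implicit Arguments.
Unset Strict Implicit.
Unset Printing Implicit Defensive.

Import GRing.Theory Num.Theory.
Local Open Scope classical_set_scope.
Local Open Scope group_scope.

(** * Subgroups as predicates *)

Section Subgroups.
Variable T : groupType.
Implicit Types (K H M N A : set T) (x y z : T) (s : seq T).

Definition is_subgroup K :=
  [/\ K 1, forall x y, K x -> K y -> K (x * y) & forall x, K x -> K x^-1].

Definition normalized_by H N := forall h x, H h -> N x -> N (h * x * h^-1).

Inductive gen A : set T :=
| gen_in x : A x -> gen A x
| gen_one : gen A 1
| gen_mul x y : gen A x -> gen A y -> gen A (x * y)
| gen_inv x : gen A x -> gen A x^-1.

Lemma gen_subgroup A : is_subgroup (gen A).
Proof. by split; [apply: gen_one | apply: gen_mul | apply: gen_inv]. Qed.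

Lemma gen_min A K : is_subgroup K -> (forall x, A x -> K x) ->
  forall x, gen A x -> K x.
Proof.
by case=> K1 KM KV AK x; elim=> // {x}; [move=> x y _ Kx _ Ky; exact: KM
  | move=> x _; exact: KV].
Qed.

Lemma gen_mono A K : (forall x, A x -> K x) -> forall x, gen A x -> gen K x.
Proof.
by move=> AK; apply: gen_min; [exact: gen_subgroup | move=> x /AK; exact: gen_in].
Qed.

Lemma subgroupX K x n : is_subgroup K -> K x -> K (x ^+ n).
Proof.
by case=> K1 KM _ Kx; elim: n => [|n IHn]; rewrite ?expg0 // expgS; apply: KM.
Qed.

Lemma subgroup_mulL K x y : is_subgroup K -> K x -> K (x * y) -> K y.
Proof. by case=> _ KM KV Kx Kxy; rewrite -(mulKg x y); apply: KM => //; exact: KV. Qed.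

Lemma subgroup_mulR K x y : is_subgroup K -> K y -> K (x * y) -> K x.
Proof. by case=> _ KM KV Kx Kxy; rewrite -(mulgK y x); apply: KM => //; exact: KV. Qed.

Lemma gen_normalized H A : is_subgroup H ->
  normalized_by H A -> normalized_by H (gen A).
Proof.
move=> [_ _ HV] nA h x Hh; elim=> [{}x Ax||{}x y _ IHx _ IHy|{}x _ IHx].
- by apply: gen_in; exact: nA.
- by rewrite mulg1 mulgV; exact: gen_one.
- have -> : h * (x * y) * h^-1 = h * x * h^-1 * (h * y * h^-1).
    by rewrite !mulgA mulgVK.
  exact: gen_mul.
- have -> : h * x^-1 * h^-1 = (h * x * h^-1)^-1 by rewrite !invgM invgK mulgA.
  exact: gen_inv.
Qed.

Lemma cosetM H N x x' y y' : is_subgroup H -> is_subgroup N ->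
  normalized_by H N -> H y -> N (x^-1 * x') -> N (y^-1 * y') ->
  N ((x * y)^-1 * (x' * y')).
Proof.
move=> [_ _ HV] [_ NM _] nN Hy Nx Ny.
have -> : (x * y)^-1 * (x' * y') =
    (y^-1 * (x^-1 * x') * y^-1^-1) * (y^-1 * y').
  by rewrite invgM invgK !mulgA mulgK.
by apply: NM => //; apply: nN => //; exact: HV.
Qed.

Lemma cosetX H N x y n : is_subgroup H -> is_subgroup N ->
  normalized_by H N -> H x -> N (x^-1 * y) ->
  N ((x ^+ n)^-1 * y ^+ n).
Proof.
move=> sH sN nN Hx Nxy; elim: n => [|n IHn].
  by rewrite !expg0 mulVg; case: sN.
by rewrite !expgS; apply: (cosetM sH) => //; exact: subgroupX.
Qed.

(** Unlike the induction principle of [gen], this one builds an element one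
    letter at a time, which is what a rewriting of words along cosets needs. *)
Lemma gen_word_ind A (P : T -> Prop) : P 1 ->
  (forall y h, A y -> P h -> P (y * h)) ->
  (forall y h, A y -> P h -> P (y^-1 * h)) ->
  forall h, gen A h -> P h.
Proof.
move=> P1 PM PV h Ah.
suff Q h' : P h' <-> P (h * h') by rewrite -(mulg1 h); exact: (Q 1).1 P1.
elim: Ah h' => {h} [y Ay|| x y _ IHx _ IHy|x _ IHx] h'.
- split=> [|Ph']; first exact: PM.
  by rewrite -(mulKg y h'); exact: PV.
- by rewrite mul1g.
- by rewrite -mulgA -IHx.
- by rewrite [X in _ <-> X]IHx mulVKg.
Qed.

(** Finite index is encoded by a finite colouring, so that products and
    intersections of colourings give the usual permanence properties. *)
Definition finite_index_in M H := exists (I : finType) (c : T -> I),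
  forall x y, H x -> H y -> c x = c y -> M (x^-1 * y).

Lemma fin_index_sub M M' H : (forall x, M x -> M' x) ->
  finite_index_in M H -> finite_index_in M' H.
Proof. by move=> MM' [I [c cM]]; exists I, c => x y Hx Hy /(cM x y Hx Hy)/MM'. Qed.

Lemma fin_index_refl H : is_subgroup H -> finite_index_in H H.
Proof.
by case=> _ HM HV; exists unit, (fun=> tt) => x y Hx Hy _; apply: HM => //; exact: HV.
Qed.

(** Colours that [H] does not meet receive an arbitrary element of [H], so that
    [r] is total. *)
Lemma color_reps H (I : finType) (c : T -> I) : is_subgroup H ->
  exists r : I -> T, (forall i, H (r i)) /\ forall x, H x -> c (r (c x)) = c x.
Proof.
case=> H1 _ _.
have reps i : exists y, H y /\ forall x, H x -> c x = i -> c y = i.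
  have [[x [Hx cx]]|no] := pselect (exists x, H x /\ c x = i).
    by exists x.
  by exists 1; split=> // x Hx cx; case: no; exists x.
have [r rP] := choice reps.
exists r; split=> [i|x Hx]; first exact: (rP i).1.
exact: (rP (c x)).2 x Hx erefl.
Qed.

Lemma fin_index_trans M N H : is_subgroup H -> is_subgroup M ->
  finite_index_in M H -> finite_index_in N M -> finite_index_in N H.
Proof.
move=> sH sM [I [c cM]] [J [d dN]].
have [r [Hr cr]] := color_reps c sH.
exists (I * J)%type, (fun x => (c x, d ((r (c x))^-1 * x))) => x y Hx Hy.
case=> cxy; rewrite cxy => dxy.
have Mr z : H z -> M ((r (c z))^-1 * z).
  by move=> Hz; apply: cM; [exact: Hr|exact: Hz|exact: cr].
have := dN _ _ _ (Mr y Hy) dxy.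
rewrite invgM invgK -mulgA mulVKg; apply.
by rewrite -cxy; exact: Mr.
Qed.

(** Pigeonhole on the colours of the powers of [x]. *)
Lemma fin_index_power M H x : is_subgroup H -> is_subgroup M -> finite_index_in M H ->
  H x -> exists2 n, (0 < n)%N & M (x ^+ n).
Proof.
move=> sH sM [I [c cM]] Hx.
pose f (i : 'I_#|I|.+1) := c (x ^+ i).
have /injectivePn[i [j ij fij]] : ~~ injectiveb f.
  apply/negP => /injectiveP/leq_card; rewrite card_ord.
  by rewrite ltnn.
wlog lt_ij : i j ij fij / (i < j)%N.
  move=> wl; case: (ltngtP i j) => [||/val_inj eij]; first exact: wl.
    by apply: wl; rewrite 1?eq_sym.
  by rewrite eij eqxx in ij.
exists (j - i)%N; first by rewrite subn_gt0.
have := cM _ _ (subgroupX i sH Hx) (subgroupX j sH Hx) fij.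
by rewrite -{1}(subnKC (ltnW lt_ij)) expgnDr mulKg.
Qed.

Definition core H M := [set x | M x /\ forall h, H h -> M (h^-1 * x * h)].

Lemma core_subgroup H M : is_subgroup M -> is_subgroup (core H M).
Proof.
case=> M1 MM MV; split=> [|x y [Mx cx] [My cy]|x [Mx cx]].
- by split=> // h _; rewrite mulg1 mulVg.
- split=> [|h Hh]; first exact: MM.
  have -> : h^-1 * (x * y) * h = h^-1 * x * h * (h^-1 * y * h).
    by rewrite !mulgA mulgK.
  by apply: MM; [exact: cx | exact: cy].
- split=> [|h Hh]; first exact: MV.
  have -> : h^-1 * x^-1 * h = (h^-1 * x * h)^-1 by rewrite !invgM invgK mulgA.
  exact/MV/cx.
Qed.

Lemma core_normalized H M : is_subgroup H -> normalized_by H (core H M).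
Proof.
move=> [_ HM HV] h x Hh [Mx cx]; split=> [|k Hk].
  by rewrite -{1}(invgK h); apply: cx; exact: HV.
have -> : k^-1 * (h * x * h^-1) * k = (h^-1 * k)^-1 * x * (h^-1 * k).
  by rewrite invgM invgK !mulgA.
by apply: cx; apply: HM => //; exact: HV.
Qed.

(** Modulo [M], conjugation by [h] depends on [h] only through its colour, so
    finitely many colourings together detect all conjugates of [M]. *)
Lemma fin_index_core H M : is_subgroup H -> is_subgroup M -> finite_index_in M H ->
  finite_index_in (core H M) H.
Proof.
move=> sH [_ MM MV] [I [c cM]]; have [r [Hr cr]] := color_reps c sH.
have [H1 HM _] := sH.
exists {ffun I -> I}, (fun x => [ffun i => c (x * r i)]) => x y Hx Hy /ffunP cxy.
suff cC h : H h -> M (h^-1 * (x^-1 * y) * h).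
  by split=> //; have := cC 1 H1; rewrite invg1 mul1g mulg1.
move=> Hh; have := cxy (c h); rewrite !ffunE => cxyh.
have Mh : M ((r (c h))^-1 * h) by apply: cM => //; exact: cr.
have -> : h^-1 * (x^-1 * y) * h = ((r (c h))^-1 * h)^-1 *
   ((x * r (c h))^-1 * (y * r (c h))) * ((r (c h))^-1 * h).
  by rewrite !invgM !invgK !mulgA !mulgK.
apply: (MM) => //; apply: (MM); first exact: MV.
by apply: cM => //; exact: HM.
Qed.

(** Schreier's lemma.  With a transversal [r], left multiplication by a generator
    [y] carries the coset of [r i] to that of some [r k] at the cost of
    [(r k)^-1 * y * r i].  These elements, and the representatives that lie in
    [M], are finitely many and generate [M]. *)
Lemma schreier s M : is_subgroup M -> finite_index_in M (gen [set` s]) ->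
  (forall x, M x -> gen [set` s] x) ->
  exists s' : seq T, (forall x, x \in s' -> M x) /\
     forall x, M x -> gen [set` s'] x.
Proof.
move=> sM [I [c cM]] MH; have [M1 MM MV] := sM.
have sH := gen_subgroup [set` s]; have [H1 HM HV] := sH.
have [r [Hr cr]] := color_reps c sH.
pose inM x : bool := `[< M x >].
pose cand := [seq r i | i <- enum I] ++
  [seq (r p.1)^-1 * y * r p.2 | p <- enum ((I * I)%type : finType),
                                y <- s ++ [seq y^-1 | y <- s]].
exists (filter inM cand); split=> [x|x Mx].
  by rewrite mem_filter => /andP[/asboolP].
have candP z : M z -> z \in cand -> gen [set` filter inM cand] z.
  by move=> Mz cz; apply: gen_in => /=; rewrite mem_filter cz andbT; apply/asboolP.
have candr i : M (r i) -> gen [set` filter inM cand] (r i).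
  by move=> Mi; apply: candP => //; rewrite mem_cat map_f ?mem_enum.
suff step y h : gen [set` s] y -> y \in s ++ [seq y^-1 | y <- s] ->
    (gen [set` s] h /\ exists i m, [/\ M m, gen [set` filter inM cand] m & h = r i * m]) ->
    (gen [set` s] (y * h) /\
     exists i m, [/\ M m, gen [set` filter inM cand] m & y * h = r i * m]).
  have [_ [i [m [Mm gm xE]]]] : gen [set` s] x /\
     exists i m, [/\ M m, gen [set` filter inM cand] m & x = r i * m].
    elim/gen_word_ind: {Mx}x / (MH x Mx) => [|y h sy|y h sy].
    - split=> //; have Mr : M (r (c 1)).
        by have := cM _ _ (Hr (c 1)) H1 (cr _ H1); rewrite mulg1 => /MV; rewrite invgK.
      exists (c 1), (r (c 1))^-1; split; [exact: MV | | by rewrite mulgV].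
      by apply: gen_inv; exact: candr.
    - by apply: step; [exact: gen_in | rewrite mem_cat sy].
    - apply: step; [by apply: gen_inv; exact: gen_in | rewrite mem_cat].
      by apply/orP; right; apply: map_f.
  rewrite xE in Mx *; apply: gen_mul => //; apply: candr.
  exact: subgroup_mulR sM Mm Mx.
move=> Hy ys [Hh [i [m [Mm gm hE]]]]; split; first exact: HM.
pose k := c (y * r i).
have Myr : M ((r k)^-1 * y * r i).
  rewrite -mulgA; apply: cM => //; first exact: HM.
  by apply: cr; exact: HM.
exists k, ((r k)^-1 * y * r i * m); split; first exact: MM.
  apply: gen_mul => //; apply: candP => //; rewrite mem_cat; apply/orP; right.
  by apply/allpairsP; exists ((k, i), y); rewrite mem_enum.
by rewrite hE !mulgA mulgV mul1g.
Qed.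

End Subgroups.

(** * Transfer *)

Section Transfer.
Variable T : groupType.
Implicit Types (R H M A : set T) (x y z : T).

Definition additive_on M (mu : T -> int) :=
  forall x y, M x -> M y -> mu (x * y) = (mu x + mu y)%R.

Lemma additive1 M mu : M 1 -> additive_on M mu -> mu 1 = 0%R.
Proof. by move=> M1 muM; have := muM 1 1 M1 M1; rewrite mulg1; lia. Qed.

Lemma additiveV M mu x : is_subgroup M -> additive_on M mu -> M x ->
  mu x^-1 = (- mu x)%R.
Proof.
move=> [M1 _ MV] muM Mx; have := muM x x^-1 Mx (MV x Mx).
by rewrite mulgV (additive1 M1 muM); lia.
Qed.

Lemma additiveX M mu x n : is_subgroup M -> additive_on M mu -> M x ->
  mu (x ^+ n) = (mu x *+ n)%R.
Proof.
move=> sM muM Mx; elim: n => [|n IHn].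
  by rewrite expg0 (additive1 _ muM) //; case: sM.
by rewrite expgS muM ?IHn ?GRing.mulrS //; exact: subgroupX.
Qed.

(** A colouring may split a coset of [M]; recolouring an element by the set of
    colours that its coset meets makes the classes equal to the cosets. *)
Lemma exact_coloring H M : is_subgroup H -> is_subgroup M -> finite_index_in M H ->
  exists (I : finType) (c : T -> I),
    forall x y, H x -> H y -> c x = c y <-> M (x^-1 * y).
Proof.
move=> sH [M1 MM MV] [I [c cM]].
exists {ffun I -> bool},
  (fun x => [ffun i => `[< exists z, [/\ H z, M (x^-1 * z) & c z = i] >]]).
move=> x y Hx Hy; split=> [/ffunP/(_ (c y))|Mxy].
  rewrite !ffunE => cxy; have [_ yx] := asbool_eq_equiv cxy.
  have [|z [Hz Mxz czy]] := yx; first by exists y; split=> //; rewrite mulVg.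
  have -> : x^-1 * y = x^-1 * z * (z^-1 * y).
    by rewrite mulgA mulgK.
  by apply: MM => //; exact: cM.
apply/ffunP => i; rewrite !ffunE; apply: asbool_equiv_eq.
split=> -[z [Hz Mz ci]]; exists z; split=> //.
  have -> : y^-1 * z = (x^-1 * y)^-1 * (x^-1 * z).
    by rewrite invgM invgK mulgA mulgK.
  by apply: MM => //; exact: MV.
have -> : x^-1 * z = x^-1 * y * (y^-1 * z) by rewrite mulgA mulgK.
exact: MM.
Qed.

(** An invariant [mu] is, up to a positive integer factor, the restriction of a
    homomorphism defined on all of [R := gen A], namely of its transfer: the
    sum over a transversal [r] of the values of [mu] at the elements
    [(r k)^-1 * q * r i] of [M].  The transfer of [a] vanishes because that of a
    power of [a] does, and a homomorphism that vanishes on generators is zero. *)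
Lemma transfer_vanishing A M mu :
  is_subgroup M -> finite_index_in M (gen A) -> normalized_by (gen A) M ->
  additive_on M mu ->
  (forall a m, A a -> M m -> mu (a * m * a^-1) = mu m) ->
  (forall a n, A a -> M (a ^+ n) -> mu (a ^+ n) = 0%R) ->
  forall x, gen A x -> M x -> mu x = 0%R.
Proof.
move=> sM fM nM muM muA mu0; set R := gen A.
have sR : is_subgroup R := gen_subgroup A.
have [R1 RM RV] := sR; have [M1 MM MV] := sM.
have muR q m : R q -> M m -> mu (q * m * q^-1) = mu m.
  move=> Rq; elim: Rq m => {q} [a Aa|| x y Rx IHx Ry IHy|x Rx IHx] m Mm.
  - exact: muA.
  - by rewrite mul1g invg1 mulg1.
  - have -> : x * y * m * (x * y)^-1 = x * (y * m * y^-1) * x^-1.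
      by rewrite invgM !mulgA.
    by rewrite IHx ?IHy //; exact: nM.
  - rewrite -(IHx (x^-1 * m * x^-1^-1)); last exact: (nM _ _ (RV _ Rx)).
    by rewrite invgK !mulgA mulgV mul1g mulgK.
have [I [c cM]] := exact_coloring sR sM fM.
have [r [Rr cr]] := color_reps c sR.
pose D i := c (r i) == i.
have Dc x : R x -> D (c x) by move=> Rx; apply/eqP/cr.
pose th q i := (r (c (q * r i)))^-1 * q * r i.
have Mth q i : R q -> M (th q i).
  by move=> Rq; rewrite /th -mulgA -cM ?cr //; exact: RM.
pose tau q := (\sum_(i | D i) mu (th q i))%R.
have tauM p q : R p -> R q -> tau (p * q) = (tau p + tau q)%R.
  move=> Rp Rq; rewrite /tau.
  have -> : (\sum_(i | D i) mu (th p i) =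
             \sum_(i | D i) mu (th p (c (q * r i)%g)))%R.
    rewrite (reindex_onto (fun i => c (q * r i)) (fun i => c (q^-1 * r i))) /=.
      apply: eq_bigl => i; rewrite Dc; last exact: RM.
      rewrite /= /D; congr (_ == i); apply/cM => //.
        by apply: RM; [exact: RV | exact: Rr].
      rewrite invgM invgK -mulgA; apply/cM => //; first exact: RM.
      by apply: cr; exact: RM.
    move=> i /eqP Di; rewrite -[RHS]Di; apply/cM => //.
      by apply: RM.
    rewrite invgM -mulgA; apply/cM => //.
      by apply: RM; [exact: RV |].
    by apply: cr; apply: RM => //; exact: RV.
  rewrite -big_split /=; apply: eq_bigr => i Di.
  rewrite -muM; [|exact: Mth|exact: Mth]; congr (mu _); rewrite /th.
  have -> : c (p * q * r i) = c (p * r (c (q * r i))).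
    have Rqr : R (q * r i) by exact: RM.
    apply/cM; [by rewrite -mulgA; exact: RM | exact: RM |].
    by rewrite -(mulgA p) invgM -mulgA mulKg; apply/cM; rewrite ?cr.
  by rewrite !mulgA mulgK.
have tau1 : tau 1 = 0%R by have := tauM 1 1 R1 R1; rewrite mulg1; lia.
have tauX q n : R q -> tau (q ^+ n) = (tau q *+ n)%R.
  move=> Rq; elim: n => [|n IHn]; first by rewrite expg0.
  by rewrite expgS tauM ?IHn ?GRing.mulrS //; exact: subgroupX.
have tauE m : R m -> M m -> tau m = (mu m *+ #|[pred i | D i]|)%R.
  move=> Rm Mm; rewrite /tau -sumr_const; apply: eq_bigr => i /eqP Di.
  suff ci : c (m * r i) = i.
    rewrite /th ci -[RHS](muR (r i)^-1) ?invgK //; exact: RV.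
  rewrite -[RHS]Di; apply/cM => //; first exact: RM.
  rewrite invgM -{2}(invgK (r i)).
  by apply: nM => //; [exact: RV | exact: MV].
have D0 : (0 < #|[pred i | D i]|)%N by apply/card_gt0P; exists (c 1); exact: Dc.
have tau0 q : R q -> tau q = 0%R.
  elim=> {q} // [a Aa|x y Rx IHx Ry IHy|x Rx IHx].
  - have Ra : R a by exact: gen_in.
    have [n n0 Man] := fin_index_power sR sM fM Ra.
    have := tauX a n Ra; rewrite tauE ?mu0 //; last exact: subgroupX.
    by rewrite mul0rn => /esym/eqP; rewrite mulrn_eq0; lia.
  - by rewrite tauM // IHx IHy.
  - by have := tauM x x^-1 Rx (RV x Rx); rewrite mulgV tau1 IHx; lia.
move=> x Rx Mx; have := tauE x Rx Mx; rewrite tau0 // => /esym/eqP.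
by rewrite mulrn_eq0; lia.
Qed.

End Transfer.

(** * Elementary amenable groups *)

Section Chou.
Variable T : groupType.
Implicit Types (K N A : set T) (x y z t : T).

(** Chou's bottom-up description of elementary amenability, inside a fixed group:
    only finite and cyclic quotients and directed unions.  The extension rules
    relate [N] to [K] through conditions on elements of [K], so that passing to
    a subgroup of [K] keeps the same [N]. *)
Inductive chou : set T -> Prop :=
| chou_trivial K : (forall x, K x -> x = 1) -> chou K
| chou_finite N K : is_subgroup N -> is_subgroup K -> chou N ->
    finite_index_in N K -> chou K
| chou_cyclic N K (lam : T -> int) : is_subgroup N -> is_subgroup K -> chou N ->
    additive_on K lam -> (forall x, K x -> lam x = 0%R -> N x) -> chou K
| chou_local K : is_subgroup K ->
    (forall s : seq T, (forall x, x \in s -> K x) -> chou (gen [set` s])) ->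
    chou K.

Lemma fin_index_restrict M H H' : (forall x : T, H' x -> H x) ->
  finite_index_in M H -> finite_index_in M H'.
Proof. by move=> HH' [I [c cM]]; exists I, c => x y /HH' Hx /HH' Hy; exact: cM. Qed.

Lemma chou_sub K K' : is_subgroup K' -> (forall x, K' x -> K x) ->
  chou K -> chou K'.
Proof.
move=> sK' K'K CK; case: CK K'K => {K}
  [K K1|N K sN sK CN fN|N K lam sN sK CN lamK lamN|K sK CK] K'K.
- by apply: chou_trivial => x /K'K/K1.
- by apply: (chou_finite sN) => //; exact: fin_index_restrict fN.
- apply: (chou_cyclic sN sK' CN (lam := lam)) => [x y /K'K Kx /K'K Ky|x /K'K].
    exact: lamK.
  exact: lamN.
- by apply: chou_local => // s sK''; apply: CK => x /sK''/K'K.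
Qed.

(** Powers of [t] commute, so elements congruent to quotients of such powers
    multiply like the exponents. *)
Lemma power_cosetM N t x y a b c d : is_subgroup N ->
  (forall z n, N z -> N ((t ^+ n)^-1 * z * t ^+ n)) ->
  N ((t ^+ a)^-1 * x * t ^+ b) -> N ((t ^+ c)^-1 * y * t ^+ d) ->
  N ((t ^+ (a + c))^-1 * (x * y) * t ^+ (b + d)).
Proof.
move=> [_ NM _] nN Nx Ny.
have -> : (t ^+ (a + c))^-1 * (x * y) * t ^+ (b + d) =
    ((t ^+ c)^-1 * ((t ^+ a)^-1 * x * t ^+ b) * t ^+ c) *
    ((t ^+ b)^-1 * ((t ^+ c)^-1 * y * t ^+ d) * t ^+ b).
  have tC u v : u * t ^+ b * t ^+ c * (t ^+ b)^-1 * (t ^+ c)^-1 * v = u * v.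
    by rewrite -(mulgA u) -expgnDr addnC expgnDr mulgA !mulgK.
  by rewrite (addnC b) !expgnDr invgM !mulgA tC.
by apply: NM; exact: nN.
Qed.

(** Adjoining one element [t] that normalizes [N] multiplies the group by a
    cyclic group: infinite if no positive power of [t] lies in [N], and finite
    otherwise.  An element congruent to [t ^+ a / t ^+ b] is recorded by the
    pair of exponents. *)
Lemma chou_adjoin N K t : is_subgroup N -> is_subgroup K -> chou N ->
  (forall x, N x -> K x) -> K t -> normalized_by K N ->
  (forall x, K x -> exists a b : nat, N ((t ^+ a)^-1 * x * t ^+ b)) ->
  chou K.
Proof.
move=> sN sK CN NK Kt nN tK; have [N1 NM NV] := sN; have [K1 KM KV] := sK.
have KX n : K (t ^+ n) by exact: subgroupX.
have nN' x n : N x -> N ((t ^+ n)^-1 * x * t ^+ n).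
  by move=> Nx; rewrite -{2}(invgK (t ^+ n)); apply: nN => //; exact: KV.
pose E x a b := N ((t ^+ a)^-1 * x * t ^+ b).
have EV x a b : E x a b -> E x^-1 b a.
  by move=> /NV; rewrite /E !invgM invgK mulgA.
have EM x y a b c d : E x a b -> E y c d -> E (x * y) (a + c)%N (b + d)%N.
  exact: power_cosetM.
have exE x : exists p : nat * nat, K x -> E x p.1 p.2.
  have [/tK[a [b Eab]]|nKx] := pselect (K x); first by exists (a, b).
  by exists (0, 0)%N => /nKx.
have [e eP] := choice exE.
have [[n [n0 Nn]]|noN] := pselect (exists n, (0 < n)%N /\ N (t ^+ n)).
  have Emod z p q : (p = q %[mod n])%N -> E z p q -> N z.
    move=> pq Ez.
    have -> : z = (t ^+ p * ((t ^+ p)^-1 * z * t ^+ q) * (t ^+ p)^-1) *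
                  (t ^+ p * (t ^+ q)^-1) by rewrite !mulgA mulgV mul1g mulgVK mulgK.
    apply: (NM); first exact: nN.
    have Nq k : N (t ^+ (k * n)) by rewrite mulnC expgnA; exact: subgroupX.
    rewrite (divn_eq p n) (divn_eq q n) pq; set r := (q %% n)%N.
    have -> : t ^+ (p %/ n * n + r) * (t ^+ (q %/ n * n + r))^-1 =
        t ^+ (p %/ n * n) * (t ^+ (q %/ n * n))^-1.
      by rewrite !expgnDr invgM !mulgA mulgK.
    by apply: NM => //; exact: NV.
  apply: (chou_finite sN sK CN).
  exists ('I_n * 'I_n)%type, (fun x =>
    (Ordinal (ltn_pmod (e x).1 n0), Ordinal (ltn_pmod (e x).2 n0))).
  move=> x y Kx Ky [exy1 exy2].
  apply: Emod (EM _ _ _ _ _ _ (EV _ _ _ (eP x Kx)) (eP y Ky)).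
  by rewrite -modnDm -exy1 exy2 modnDm addnC.
have E1 a b : E 1 a b -> a = b.
  rewrite /E mulg1 => Nab; case: (ltngtP a b) => // lt; case: noN.
    exists (b - a)%N; rewrite subn_gt0; split=> //.
    by move: Nab; rewrite -(subnKC (ltnW lt)) expgnDr mulKg addKn.
  exists (a - b)%N; rewrite subn_gt0; split=> //.
  move: Nab => /NV; rewrite invgM invgK.
  by rewrite -(subnKC (ltnW lt)) expgnDr mulKg addKn.
pose lam x := ((e x).1%:Z - (e x).2%:Z)%R.
apply: (chou_cyclic sN sK CN (lam := lam)) => [x y Kx Ky|x Kx].
  have Kxy := KM _ _ Kx Ky.
  have := EM _ _ _ _ _ _ (EM _ _ _ _ _ _ (EV _ _ _ (eP _ Kxy)) (eP x Kx)) (eP y Ky).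
  by rewrite -mulgA mulVg => /E1; rewrite /lam; lia.
rewrite /lam => exx; have Ex := eP x Kx.
have -> : x = t ^+ (e x).1 * ((t ^+ (e x).1)^-1 * x * t ^+ (e x).2) * (t ^+ (e x).1)^-1.
  have -> : (e x).2 = (e x).1 by lia.
  by rewrite !mulgA mulgV mul1g mulgK.
exact: nN.
Qed.

(** An extension with abelian quotient is reached locally by adjoining
    generators one at a time. *)
Lemma chou_abelian N K : is_subgroup N -> is_subgroup K -> chou N ->
  (forall x, N x -> K x) ->
  (forall x y, K x -> K y -> N ([~ x, y])) -> chou K.
Proof.
move=> sN sK CN NK cN; have [K1 KM KV] := sK.
apply: chou_local => // s sKs.
suff : chou (gen (N `|` [set` s])).
  apply: chou_sub; first exact: gen_subgroup.
  by apply: gen_mono => x sx; right.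
elim: s sKs => [|t s IHs] sKs.
  apply: chou_sub CN; first exact: gen_subgroup.
  by apply: gen_min => // x [].
have Ks x : x \in s -> K x by move=> sx; apply: sKs; rewrite inE sx orbT.
have Kt : K t by apply: sKs; rewrite mem_head.
set M := gen (N `|` [set` s]); set L := gen _.
have sM : is_subgroup M by exact: gen_subgroup.
have sL : is_subgroup L by exact: gen_subgroup.
have NM x : N x -> M x by move=> Nx; apply: gen_in; left.
have LK x : L x -> K x.
  apply: gen_min => // {}x [/NK//|/=]; exact: sKs.
have MK x : M x -> K x by apply: gen_min => // {}x [/NK//|/=]; exact: Ks.
have [M1 MM MV] := sM.
have nM : normalized_by K M.
  move=> h x Kh Mx; have Kx := MK _ Mx.
  have -> : h * x * h^-1 = x * [~ x, h^-1].
    by rewrite /commg /conjg invgK !mulgA mulgV mul1g.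
  by apply: MM => //; apply: NM; apply: cN => //; exact: KV.
have LM x : M x -> L x.
  by apply: gen_mono => {}x [Nx|/= sx]; [left | right; rewrite /= inE sx orbT].
have Lt : L t by apply: gen_in; right; rewrite /= mem_head.
apply: (chou_adjoin sM sL _ LM Lt) => [|h x /LK Kh|x].
- exact: IHs.
- exact: nM.
have KX n : K (t ^+ n) by exact: subgroupX.
have nM' z n : M z -> M ((t ^+ n)^-1 * z * t ^+ n).
  by move=> Mz; rewrite -{2}(invgK (t ^+ n)); apply: nM => //; exact: KV.
elim=> [{}x Nsx||{}x y Lx [a [b Ex]] Ly [c [d Ey]]|{}x Lx [a [b Ex]]].
- have [Mx|->] : M x \/ x = t.
    case: Nsx => [/NM|/=]; first by left.
    by rewrite inE => /orP[/eqP|sx]; [right | left; apply: gen_in; right].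
  + by exists 0%N, 0%N; rewrite expg0 invg1 mul1g mulg1.
  + by exists 1%N, 0%N; rewrite expg1 expg0 mulVg mulg1.
- by exists 0%N, 0%N; rewrite expg0 invg1 !mulg1.
- exists (a + c)%N, (b + d)%N.
  exact: power_cosetM.
- by exists b, a; move: (MV _ Ex); rewrite !invgM invgK mulgA.
Qed.
End Chou.

Section SubquotientLifting.
Variable T : groupType.

Lemma multiplicative1 (A B : groupType) (f : {multiplicative A -> B}) : f 1 = 1.
Proof. by apply: (mulgI (f 1)); rewrite -gmulfM !mulg1. Qed.

Lemma multiplicativeV (A B : groupType) (f : {multiplicative A -> B}) (x : A) :
  f x^-1 = (f x)^-1.
Proof. by apply: (mulgI (f x)); rewrite -gmulfM !mulgV multiplicative1. Qed.

Definition group_relation (A : groupType) (R : T -> A -> Prop) :=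
  [/\ R 1 1, forall t a u b, R t a -> R u b -> R (t * u) (a * b)
    & forall t a, R t a -> R t^-1 a^-1].

Definition rel_kernel (A : groupType) (R : T -> A -> Prop) : set T :=
  [set t | R t 1].
Definition rel_domain (A : groupType) (R : T -> A -> Prop) : set T :=
  [set t | exists a, R t a].

(** A subgroup of [T * A] presents a subgroup of [T] as an extension of its
    kernel by a subgroup of [A].  Quantifying over all of them at once gives a
    property of [A] for which quotients and extensions are formal. *)
Definition lifts_chou (A : groupType) :=
  forall R : T -> A -> Prop, group_relation R ->
    chou (rel_kernel R) -> chou (rel_domain R).

Section Relation.
Variables (A : groupType) (R : T -> A -> Prop).
Hypothesis gR : group_relation R.

Lemma rel_kernel_subgroup : is_subgroup (rel_kernel R).
Proof.
case: gR => R1 RM RV; split=> // [x y Rx Ry|x Rx].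
  by have := RM _ _ _ _ Rx Ry; rewrite mulg1.
by have := RV _ _ Rx; rewrite invg1.
Qed.

Lemma rel_domain_subgroup : is_subgroup (rel_domain R).
Proof.
case: gR => R1 RM RV; split=> [|x y [a Ra] [b Rb]|x [a Ra]].
- by exists 1.
- by exists (a * b); exact: RM.
- by exists a^-1; exact: RV.
Qed.

Lemma rel_kernelE x y a : R x a -> R y a -> rel_kernel R (x^-1 * y).
Proof.
case: gR => _ RM RV Rx Ry; have := RM _ _ _ _ (RV _ _ Rx) Ry.
by rewrite mulVg.
Qed.

Lemma rel_kernel_domain x : rel_kernel R x -> rel_domain R x.
Proof. by move=> Rx; exists 1. Qed.

Lemma lift_finite : finite_group A -> chou (rel_kernel R) -> chou (rel_domain R).
Proof.
move=> /finite_seqP[s sE] cR; have sP a : a \in s.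
  by have : [set: A] a by []; rewrite sE.
apply: (chou_finite rel_kernel_subgroup rel_domain_subgroup cR).
have exa t : exists a, rel_domain R t -> R t a.
  have [[a Ra]|nR] := pselect (rel_domain R t); first by exists a.
  by exists 1 => /nR.
have [f fR] := choice exa.
exists (seq_sub s), (fun t => SeqSub (sP (f t))) => x y Dx Dy [fxy].
by apply: (@rel_kernelE _ _ (f x)); [exact: fR | rewrite fxy; exact: fR].
Qed.

Lemma lift_abelian : abelian_group A -> chou (rel_kernel R) -> chou (rel_domain R).
Proof.
move=> abA cR.
apply: (chou_abelian rel_kernel_subgroup rel_domain_subgroup cR).
  exact: rel_kernel_domain.
move=> x y [a Ra] [b Rb]; case: gR => _ RM RV.
have := RM _ _ _ _ (RV _ _ Ra) (RM _ _ _ _ (RV _ _ Rb) (RM _ _ _ _ Ra Rb)).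
by rewrite (abA a b) mulKg mulVg.
Qed.

End Relation.

Lemma lift_isomorphic (A B : groupType) (f : {multiplicative A -> B}) :
  bijective f -> lifts_chou A -> lifts_chou B.
Proof.
move=> [g fK gK] lA R [R1 RM RV] cR.
pose S t a := R t (f a).
have gS : group_relation S.
  split=> [|t a u b Ra Rb|t a Ra]; rewrite /S ?multiplicative1 //.
    by rewrite gmulfM; exact: RM.
  by rewrite multiplicativeV; exact: RV.
have -> : rel_domain R = rel_domain S.
  apply/funext => t; apply/propext; split=> -[a Ra]; last by exists (f a).
  by exists (g a); rewrite /S gK.
by apply: lA => //; rewrite /rel_kernel /S multiplicative1.
Qed.

Lemma lift_subgroup (A : groupType) (B : groupClosed A) :
  lifts_chou A -> lifts_chou (subgroup B).
Proof.
move=> lA R [R1 RM RV] cR.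
pose S t a := exists b : subgroup B, R t b /\ val b = a.
have gS : group_relation S.
  split=> [|t _ u _ [a [Ra <-]] [b [Rb <-]]|t _ [a [Ra <-]]].
  - by exists 1.
  - by exists (a * b); split; [exact: RM |].
  - by exists a^-1; split; [exact: RV |].
have -> : rel_domain R = rel_domain S.
  apply/funext => t; apply/propext; split=> [[a Ra]|[_ [a [Ra _]]]].
    by exists (val a), a.
  by exists a.
apply: lA => //; suff -> : rel_kernel S = rel_kernel R by [].
apply/funext => t; apply/propext; split=> [[a [Ra a1]]|Rt]; last by exists 1.
by have a1' : a = 1; [exact: val_inj | rewrite a1' in Ra].
Qed.

Lemma pi_quotient1 (A : groupType) (N : normalSubgroup A) (a : A) :
  \pi_(quotient N)%qT a = 1 <-> a \in N.
Proof.
have eqE : (\pi_(quotient N)%qT a == \pi_(quotient N)%qT 1) = (a \in N).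
  rewrite -[RHS]gpredV -[in RHS](mulg1 a^-1).
  by apply/eqP/idP => [/(@eqquotP _ _ (quotient N))|/(@eqquotP _ _ (quotient N))].
by rewrite -eqE; split=> /eqP.
Qed.

Lemma lift_quotient (A : groupType) (N : normalSubgroup A) :
  lifts_chou A -> lifts_chou (quotient N).
Proof.
move=> lA R [R1 RM RV] cR.
pose S t a := R t (\pi_(quotient N)%qT a).
have gS : group_relation S.
  split=> [//|t a u b Ra Rb|t a Ra]; rewrite /S.
    by rewrite -pi_quotientM; exact: RM.
  by rewrite -pi_quotientV; exact: RV.
have -> : rel_domain R = rel_domain S.
  apply/funext => t; apply/propext; split=> -[a Ra].
    by exists (repr a); rewrite /S reprK.
  by exists (\pi_(quotient N)%qT a).
exact: lA.
Qed.

Lemma lift_extension (A : groupType) (N : normalSubgroup A) :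
  lifts_chou (subgroup N) -> lifts_chou (quotient N) -> lifts_chou A.
Proof.
move=> lN lQ R [R1 RM RV] cR.
pose S t (b : quotient N) := exists a, R t a /\ \pi_(quotient N)%qT a = b.
have gS : group_relation S.
  split=> [|t _ u _ [a [Ra <-]] [b [Rb <-]]|t _ [a [Ra <-]]].
  - by exists 1.
  - by exists (a * b); split; [exact: RM | rewrite -pi_quotientM].
  - by exists a^-1; split; [exact: RV | rewrite -pi_quotientV].
pose U t (n : subgroup N) := R t (val n).
have gU : group_relation U.
  split=> [//|t a u b Ra Rb|t a Ra]; rewrite /U; first exact: RM.
  exact: RV.
have -> : rel_domain R = rel_domain S.
  apply/funext => t; apply/propext; split=> [[a Ra]|[_ [a [Ra _]]]].
    by exists (\pi_(quotient N)%qT a), a.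
  by exists a.
apply: lQ => //; suff -> : rel_kernel S = rel_domain U by exact: lN.
apply/funext => t; apply/propext; split=> [[a [Ra /pi_quotient1 Na]]|[n Rn]].
  by exists (Subgroup Na).
by exists (val n); split=> //; apply/pi_quotient1; case: n Rn.
Qed.

(** A finitely generated subgroup of the domain only involves finitely many
    elements of the limit, and these come from a single group of the system. *)
Lemma lift_direct_limit (S : directedSystem) (L : groupType)
    (iota : forall i, {multiplicative @ds_group S i -> L}) :
  (forall i : ds_index S, lifts_chou (ds_group i)) -> is_direct_limit iota -> lifts_chou L.
Proof.
move=> lS limL R gR cR; have [R1 RM RV] := gR.
have [surj _] := limL; have [iotaE _] := direct_limit_universal limL.
apply: chou_local; first exact: rel_domain_subgroup.
move=> s sR.
have [i iP] : exists i : ds_index S,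
    forall t, t \in s -> exists a : ds_group i, R t (iota i a).
  elim: s sR => [|t s IHs] sR; first by have [i] := ds_inhabited S; exists i.
  have [|i iP] := IHs; first by move=> u us; apply: sR; rewrite inE us orbT.
  have [a Ra] := sR t (mem_head _ _); have [j [b bE]] := surj a.
  have [k [ik jk]] := ds_directed i j; exists k => u.
  rewrite inE => /orP[/eqP ->|/iP[c Rc]].
    by exists (ds_map jk b); rewrite iotaE bE.
  by exists (ds_map ik c); rewrite iotaE.
pose U t a := R t (iota i a).
have gU : group_relation U.
  split=> [|t a u b Ra Rb|t a Ra]; rewrite /U ?multiplicative1 //.
    by rewrite gmulfM; exact: RM.
  by rewrite multiplicativeV; exact: RV.
apply: (@chou_sub _ (rel_domain U)).
- exact: gen_subgroup.
- by apply: gen_min; [exact: rel_domain_subgroup | exact: iP].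
- by apply: lS => //; rewrite /rel_kernel /U multiplicative1.
Qed.

Lemma elementary_amenable_lifts (A : groupType) :
  elementary_amenable A -> lifts_chou A.
Proof.
elim=> {A} [A fA|A abA|A B f bf _|A B _|A N _|A N _ lN _|S L iota _ lS].
- by move=> R gR; exact: lift_finite.
- by move=> R gR; exact: lift_abelian.
- exact: lift_isomorphic bf.
- exact: lift_subgroup.
- exact: lift_quotient.
- exact: lift_extension lN.
- exact: lift_direct_limit lS.
Qed.

(** Chou's theorem, read off from the diagonal relation. *)
Theorem elementary_amenable_chou (G : groupClosed T) :
  elementary_amenable (subgroup G) -> chou [set x | x \in G].
Proof.
move=> /elementary_amenable_lifts lG.
pose R t (g : subgroup G) := t = val g.
have gR : group_relation R.
  by split=> [//|t a u b -> ->|t a ->].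
have -> : [set x | x \in G] = rel_domain R.
  apply/funext => t; apply/propext; split=> [Gt|[[g Gg] ->]] //.
  by exists (Subgroup Gt).
by apply: lG => //; apply: chou_trivial => x ->.
Qed.

End SubquotientLifting.

(** * Automorphisms of the rooted tree *)

Section TreeAutomorphisms.
Variable X : finType.
Local Notation T := (tree_aut X).
Implicit Types (g h k : T) (x y z : X) (u v w : seq X).

Lemma autM g h w : (g * h) w = g (h w).
Proof. by []. Qed.

Lemma autK g w : g^-1 (g w) = w.
Proof. by rewrite -autM mulVg. Qed.

Lemma autKV g w : g (g^-1 w) = w.
Proof. by rewrite -autM mulgV. Qed.

Lemma aut_inj g : injective g.
Proof. exact: can_inj (autK g). Qed.

Lemma aut_nil g : g [::] = [::].
Proof.
have : prefix (g [::]) (g (g^-1 [::])) by rewrite tree_aut_prefix prefix0s.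
by rewrite autKV prefixs0 => /eqP.
Qed.

Lemma leq_size_aut g w : (size w <= size (g w))%N.
Proof.
elim/last_ind: w => [//|w x IHw]; rewrite size_rcons.
apply: leq_ltn_trans IHw _.
have : prefix (g w) (g (rcons w x)) by rewrite tree_aut_prefix prefix_rcons.
case/prefixP=> [[|y v]] E; last by rewrite E size_cat /= addnS ltnS leq_addr.
have : size (rcons w x) = size w.
  by rewrite cats0 in E; rewrite (aut_inj E).
by rewrite size_rcons => /eqP; rewrite -{2}(addn0 (size w)) -addn1 eqn_add2l.
Qed.

(** A word of length [n] is the top of a chain of [n] strict prefixes; both [g] and
    its inverse preserve such chains, so neither can lower a length. *)
Lemma size_aut g w : size (g w) = size w.
Proof.
by apply/eqP; rewrite eqn_leq leq_size_aut -{2}(autK g w) leq_size_aut.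
Qed.

Definition root_perm g x : X := head x (g [:: x]).

Lemma aut1letter g x : g [:: x] = [:: root_perm g x].
Proof.
by rewrite /root_perm; have := size_aut g [:: x]; case: (g _) => [|y []].
Qed.

Notation "g @ x" := (section g [:: x]) (at level 20).

Lemma aut_cons g x w : g (x :: w) = root_perm g x :: (g @ x) w.
Proof. by rewrite -cat1s (section_funE g [:: x] w) aut1letter. Qed.

Lemma sectionE g w h : (forall u, g (w ++ u) = g w ++ h u) -> section g w = h.
Proof. by move=> gh; symmetry; apply/sectionP. Qed.

Lemma section_cat_eq g w u : g (w ++ u) = g w ++ section g w u.
Proof. exact: section_funE. Qed.

Lemma sectionM g h w : section (g * h) w = section g (h w) * section h w.
Proof. by apply: sectionE => u; rewrite !autM !section_cat_eq. Qed.

Lemma section1 w : section (1 : T) w = 1.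
Proof. exact: sectionE. Qed.

Lemma sectionV g w : section g^-1 (g w) = (section g w)^-1.
Proof.
apply: (mulIg (section g w)).
by rewrite -sectionM !mulVg section1.
Qed.

Lemma section_cat g u v : section g (u ++ v) = section (section g u) v.
Proof. by apply: sectionE => w; rewrite -!catA !section_cat_eq -catA. Qed.

Lemma section_nil g : section g [::] = g.
Proof. by apply: sectionE => u; rewrite aut_nil. Qed.

Lemma root_permM g h x : root_perm (g * h) x = root_perm g (root_perm h x).
Proof. by rewrite {1}/root_perm autM !aut1letter. Qed.

Lemma root_perm1 x : root_perm 1 x = x.
Proof. by []. Qed.

Lemma root_permK g : cancel (root_perm g) (root_perm g^-1).
Proof. by move=> x; rewrite -root_permM mulVg root_perm1. Qed.

Lemma root_permKV g : cancel (root_perm g^-1) (root_perm g).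
Proof. by move=> x; rewrite -root_permM mulgV root_perm1. Qed.

Lemma root_perm_inj g : injective (root_perm g).
Proof. exact: can_inj (root_permK g). Qed.

Lemma root_permX g n x : root_perm (g ^+ n) x = iter n (root_perm g) x.
Proof.
by elim: n => [|n IHn]; rewrite ?root_perm1 // expgS root_permM IHn.
Qed.

Lemma lsectionM g h x : (g * h) @ x = (g @ root_perm h x) * (h @ x).
Proof. by rewrite sectionM aut1letter. Qed.

Lemma lsectionV g x : g^-1 @ root_perm g x = (g @ x)^-1.
Proof. by rewrite -aut1letter sectionV. Qed.

Lemma aut_eqP g h : root_perm g =1 root_perm h ->
  (forall x, g @ x = h @ x) -> g = h.
Proof.
move=> gh sgh; apply: tree_aut_eq => -[|x w]; first by rewrite !aut_nil.
by rewrite !aut_cons gh sgh.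
Qed.

(** The section of a power is the product of the sections met along the orbit. *)
Lemma section_power_trivial g x n :
  (forall i, (i < n)%N -> g @ iter i (root_perm g) x = 1) -> (g ^+ n) @ x = 1.
Proof.
elim: n => [|n IHn] triv; first exact: section1.
rewrite expgS lsectionM root_permX triv // mul1g; apply: IHn => i lt_in.
exact: triv (ltnW lt_in).
Qed.

Definition fixes_letters g := forall x, root_perm g x = x.

Lemma fixes_lettersM g h : fixes_letters g -> fixes_letters h -> fixes_letters (g * h).
Proof. by move=> fg fh x; rewrite root_permM fh. Qed.

Lemma fixes_lettersV g : fixes_letters g -> fixes_letters g^-1.
Proof. by move=> fg x; rewrite -{1}(fg x) root_permK. Qed.

Lemma fixes_letters1 : fixes_letters 1.
Proof. by move=> x; rewrite root_perm1. Qed.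

Lemma section_fixedV g x : root_perm g x = x -> g^-1 @ x = (g @ x)^-1.
Proof. by move=> gx; rewrite -lsectionV gx. Qed.

Lemma section_fixedX g x n : root_perm g x = x -> (g ^+ n) @ x = (g @ x) ^+ n.
Proof.
move=> gx; elim: n => [|n IHn]; first exact: section1.
rewrite !expgS lsectionM root_permX IHn; congr (g @ _ * _).
by elim: n {IHn} => //= n ->.
Qed.

Lemma root_perm_conj g p x : root_perm g x = x ->
  root_perm (p * g * p^-1) (root_perm p x) = root_perm p x.
Proof. by move=> gx; rewrite !root_permM root_permK gx. Qed.

Lemma section_conj g p x : root_perm g x = x ->
  (p * g * p^-1) @ root_perm p x = p @ x * (g @ x) * (p @ x)^-1.
Proof. by move=> gx; rewrite lsectionM root_permK lsectionV lsectionM gx. Qed.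

Lemma fixes_letters_subgroup : is_subgroup [set g | fixes_letters g].
Proof.
by split; [exact: fixes_letters1 | exact: fixes_lettersM | exact: fixes_lettersV].
Qed.

Lemma exp_fixes_letters g : exists2 n, (0 < n)%N & fixes_letters (g ^+ n).
Proof.
have sT : is_subgroup [set: T] by [].
apply: (fin_index_power sT fixes_letters_subgroup) => //.
exists {ffun X -> X}, (fun k => [ffun x => root_perm k x]) => k h _ _ /ffunP kh x.
by have := kh x; rewrite !ffunE root_permM => <-; rewrite root_permK.
Qed.

End TreeAutomorphisms.
Notation "g @ x" := (section g [:: x]) (at level 20).

(** * Locally finite by virtually abelian groups *)

Section LocallyFinite.
Variable T : groupType.
Implicit Types (A K N : set T) (x y : T).

Definition locfin N := forall s : seq T, (forall x, x \in s -> N x) ->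
  finite_index_in [set 1] (gen [set` s]).

Definition commutators A : set T :=
  [set x | exists a b, [/\ A a, A b & x = [~ a, b]]].

(** A finite-index subgroup with locally finite derived subgroup: unlike a
    normal locally finite subgroup with virtually abelian quotient, this passes
    to products and to overgroups of finite index without any normality. *)
Definition virtually_locfin_by_abelian K := exists A,
  [/\ is_subgroup A, forall x, A x -> K x, finite_index_in A K
    & locfin (gen (commutators A))].

Lemma locfin_sub N N' : (forall x, N' x -> N x) -> locfin N -> locfin N'.
Proof. by move=> N'N lN s sN'; apply: lN => x /sN'/N'N. Qed.

Definition gen_pred (A : set T) : {pred T} := fun x => `[< gen A x >].

Lemma gen_predP A x : reflect (gen A x) (x \in gen_pred A).
Proof. exact: asboolP. Qed.

Lemma gen_pred1 A : 1 \in gen_pred A.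
Proof. by apply/gen_predP; exact: gen_one. Qed.

Lemma gen_predM A : mulg_closed (gen_pred A).
Proof. by move=> x y /gen_predP Ax /gen_predP Ay; apply/gen_predP; exact: gen_mul. Qed.

Lemma gen_predV A : invg_closed (gen_pred A).
Proof. by move=> x /gen_predP Ax; apply/gen_predP; exact: gen_inv. Qed.

HB.instance Definition _ A := isMulClosed.Build T (gen_pred A) (@gen_predM A).
HB.instance Definition _ A := isMul1Closed.Build T (gen_pred A) (@gen_pred1 A).
HB.instance Definition _ A := isInvClosed.Build T (gen_pred A) (@gen_predV A).

Lemma generatedP A x : x \in generated A <-> gen A x.
Proof.
split=> [/asboolP gA|].
  by apply/gen_predP; apply: gA => y Ay; apply/gen_predP; exact: gen_in.
elim=> {x} [x Ax||x y _ IHx _ IHy|x _ IHx].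
- by apply/asboolP => H; exact.
- exact: generated1.
- exact: generatedM.
- exact: generatedV.
Qed.

Lemma groupClosed_subgroup (G : groupClosed T) : is_subgroup [set x | x \in G].
Proof.
split=> [|x y /= Gx Gy|x /= Gx]; first exact: gpred1.
  exact: gpredM.
by rewrite gpredV.
Qed.

End LocallyFinite.

Lemma inj_color_finite (U : Type) (I : finType) (f : U -> I) :
  injective f -> finite_set [set: U].
Proof.
move=> f_inj; have : finite_set (f @^-1` [set: I]).
  by apply: finite_preimage => [x y _ _ /f_inj|].
by rewrite preimage_setT.
Qed.

Section FinalForm.
Variables (T : groupType) (G : groupClosed T).

Lemma group_by_of_virtually :
  virtually_locfin_by_abelian [set x | x \in G] ->
  group_by locally_finite virtually_abelian (subgroup G).
Proof.
move=> [A [sA AG fA lA]].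
have sG := groupClosed_subgroup G.
have fC := fin_index_core sG sA fA; have sC := core_subgroup [set x | x \in G] sA.
have nC := @core_normalized _ _ A sG.
set C := core _ A in fC sC nC; pose C' : set (subgroup G) := [set g | C (val g)].
pose D := gen_pred (commutators C').
have D_conj (x g : subgroup G) : x \in D -> x ^ g \in D.
  move=> /gen_predP Dx; apply/gen_predP.
  have -> : x ^ g = g^-1 * x * g^-1^-1 by rewrite /conjg invgK mulgA.
  apply: (@gen_normalized _ [set: subgroup G]) => // {x Dx} h _ _ [a [b [Ca Cb ->]]].
  exists (a ^ h^-1), (b ^ h^-1); split.
  - by rewrite /C' /= /conjg invgK mulgA; apply: nC => //; exact: valP.
  - by rewrite /C' /= /conjg invgK mulgA; apply: nC => //; exact: valP.
  - by rewrite -conjRg conjgE invgK [RHS]mulgA.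
exists (NormalSubgroup D_conj); split.
- move=> B /finite_seqP[s ->].
  have valD (z : subgroup D) : gen (commutators A) (val (val z)).
    case: z => z /= /gen_predP; elim=> {z} [_ [a [b [[Aa _] [Ab _] ->]]]||x y _ IHx _ IHy|x _ IHx].
    + by apply: gen_in; exists (val a), (val b).
    + exact: gen_one.
    + exact: gen_mul.
    + exact: gen_inv.
  have [|I [c cI]] := lA [seq val (val z) | z <- s].
    by move=> x /mapP[z _ ->].
  apply: (@inj_color_finite _ I (fun z => c (val (val (val z))))) => z1 z2 cz.
  have valB (z : subgroup (generated [set` s])) :
      gen [set` [seq val (val z) | z <- s]] (val (val (val z))).
    case: z => z /= /generatedP; elim=> {z} [x /= xs||x y _ IHx _ IHy|x _ IHx].
    + by apply: gen_in; apply/mapP; exists x.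
    + exact: gen_one.
    + exact: gen_mul.
    + exact: gen_inv.
  have /(mulg1_eq) := cI _ _ (valB z1) (valB z2) cz.
  by rewrite invgK => /val_inj/val_inj/val_inj.
- pose Q := quotient (NormalSubgroup D_conj).
  pose H : groupClosed Q := gen_pred [set \pi_Q%qT a | a in C'].
  have HC (q : Q) : q \in H -> exists2 a, C' a & \pi_Q%qT a = q.
    case: sC => C1 CM CV.
    move=> /gen_predP; elim=> {q} [//||_ _ _ [a Ca <-] _ [b Cb <-]|_ _ [a Ca <-]].
    + by exists 1.
    + by exists (a * b); [exact: CM | rewrite -pi_quotientM].
    + by exists a^-1; [exact: CV | rewrite -pi_quotientV].
  exists H; split; last first.
    move=> [p Hp] [q Hq]; apply: val_inj => /=.
    have [a Ca <-] := HC _ Hp; have [b Cb <-] := HC _ Hq.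
    apply: etrans (pi_quotientM _ a b) _; apply: etrans (esym (pi_quotientM _ b a)).
    symmetry; apply/(@eqquotP _ _ Q).
    rewrite /= /eqmod_coset /=; apply/gen_predP; apply: gen_in; exists a, b; split=> //.
    by rewrite /= commgEl conjgE invgM !mulgA.
  have [I [c cC]] := fC.
  have [r [Gr cr]] := color_reps c sG.
  pose r' i : subgroup G := Subgroup (Gr i).
  apply: (@sub_finite_set _ _ [set left_coset H (\pi_Q%qT (r' i)) | i in [set: I]]).
    move=> _ [q _ <-]; exists (c (val (repr q))) => //.
    set i := c _.
    have Cq : C ((val (repr q))^-1 * r i).
      by apply: cC; [exact: valP | exact: Gr | rewrite cr //; exact: valP].
    have HqH : q^-1 * \pi_Q%qT (r' i) \in H.
      apply/gen_predP; apply: gen_in; exists ((repr q)^-1 * r' i) => //.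
      by rewrite -pi_quotientM -pi_quotientV reprK.
    apply/seteqP; split=> _ [h Hh <-].
      exists (q^-1 * \pi_Q%qT (r' i) * h); first by rewrite /= gpredM.
      by rewrite !mulgA mulgV mul1g.
    exists ((q^-1 * \pi_Q%qT (r' i))^-1 * h); first by rewrite /= gpredM ?gpredV.
    by rewrite invgM invgK !mulgA mulgV mul1g.
  exact: finite_image.
Qed.

End FinalForm.

Section LocallyFiniteTree.
Variable X : finType.
Local Notation T := (tree_aut X).
Implicit Types (K A N : set T) (g h k : T) (x : X) (w : seq X).

Lemma sections_gen x A (B : set T) :
  (forall k, A k -> root_perm k x = x /\ B (k @ x)) ->
  forall k, gen A k -> root_perm k x = x /\ gen B (k @ x).
Proof.
move=> AB k; elim=> {k} [k Ak||g h _ [gx IHg] _ [hx IHh]|k _ [kx IHk]].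
- by have [kx Bk] := AB k Ak; split=> //; exact: gen_in.
- by split; [exact: root_perm1 | rewrite section1; exact: gen_one].
- split; first by rewrite root_permM hx.
  by rewrite lsectionM hx; exact: gen_mul.
- split; first by rewrite -{1}kx root_permK.
  by rewrite section_fixedV //; exact: gen_inv.
Qed.

(** Up to finite index the group acts trivially on letters and then embeds in the
    product of its section groups, where finite index and local finiteness of
    derived subgroups can be checked one letter at a time. *)
Lemma virtually_of_sections K (H : X -> set T) : is_subgroup K ->
  (forall x k, K k -> H x (k @ x)) ->
  (forall x, virtually_locfin_by_abelian (H x)) ->
  virtually_locfin_by_abelian K.
Proof.
move=> sK KH vH; have [K1 KM KV] := sK.
have [A AP] := choice vH.
pose B := [set k | [/\ K k, fixes_letters k & forall x, A x (k @ x)]].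
have sB : is_subgroup B.
  split=> [|g h [Kg fg Ag] [Kh fh Ah]|g [Kg fg Ag]].
  - split=> // x; rewrite section1; by case: (AP x) => -[].
  - split=> [||x]; [exact: KM | exact: fixes_lettersM |].
    by rewrite lsectionM fh; case: (AP x) => -[_ AM _] _ _ _; exact: AM.
  - split=> [||x]; [exact: KV | exact: fixes_lettersV |].
    by rewrite section_fixedV //; case: (AP x) => -[_ _ AV] _ _ _; exact: AV.
exists B; split=> // [k []//||].
  have cE x : exists p : {I : finType & T -> I},
      forall g h, H x g -> H x h -> projT2 p g = projT2 p h -> A x (g^-1 * h).
    by case: (AP x) => _ _ [I [c cA]] _; exists (existT _ I c).
  have [p pA] := choice cE.
  exists ({ffun X -> X} * {dffun forall x, projT1 (p x)})%type.
  exists (fun k => ([ffun x => root_perm k x], finfun (fun x => projT2 (p x) (k @ x)))).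
  move=> g h Kg Kh [/ffunP rgh sgh].
  have gh x : root_perm g x = root_perm h x by have := rgh x; rewrite !ffunE.
  split=> [|x|x]; first by apply: KM => //; exact: KV.
    by rewrite root_permM -gh root_permK.
  rewrite lsectionM -gh lsectionV; apply: pA; [exact: KH | exact: KH |].
  have := congr1 (fun f : {dffun forall x, projT1 (p x)} => f x) sgh.
  by rewrite /= !ffunE.
move=> s sB'.
have comB x k : commutators B k ->
    root_perm k x = x /\ commutators (A x) (k @ x).
  move=> [a [b [[Ka fa Aa] [Kb fb Ab] ->]]].
  have fV := fixes_lettersV; have fM := fixes_lettersM.
  have fab : fixes_letters (a * b) by exact: fM.
  split; first by rewrite /commg /conjg !root_permM !(fV _ _ _) // fb fa.
  exists (a @ x), (b @ x); split=> //.
  rewrite /commg /conjg !lsectionM !root_permM !(fV _ _ _) // !fb !fa.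
  by rewrite !section_fixedV.
have sP x k : k \in s -> root_perm k x = x /\ gen (commutators (A x)) (k @ x).
  by move=> ks; apply: (sections_gen (comB x)); exact: sB'.
have gP x k : gen [set` s] k ->
    root_perm k x = x /\ gen [set` [seq k @ x | k <- s]] (k @ x).
  apply: sections_gen => {}k /= ks.
  by split; [exact: (sP x k ks).1 | exact: map_f].
have cE x : exists p : {I : finType & T -> I},
    forall g h, gen [set` s] g -> gen [set` s] h ->
    projT2 p (g @ x) = projT2 p (h @ x) -> g @ x = h @ x.
  have [_ _ _ lA] := AP x.
  have [|I [c cA]] := lA [seq k @ x | k <- s].
    by move=> _ /mapP[k ks ->]; exact: (sP x k ks).2.
  exists (existT _ I c) => g h /(gP x)[_ sg] /(gP x)[_ sh] /= cgh.
  by have /mulg1_eq := cA _ _ sg sh cgh; rewrite invgK.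
have [p pA] := choice cE.
exists ({dffun forall x, projT1 (p x)} : finType).
exists (fun k => finfun (fun x => projT2 (p x) (k @ x))).
move=> g h sg sh /= cgh; suff -> : g = h by rewrite mulVg.
apply: aut_eqP => x; first by rewrite (gP x g sg).1 (gP x h sh).1.
apply: pA => //.
have := congr1 (fun f : {dffun forall x, projT1 (p x)} => f x) cgh.
by rewrite /= !ffunE.
Qed.

(** Automorphisms fixing every word over [Om], and whose sections at these words
    act on the other letters with trivial sections, form a subgroup of a
    (possibly infinite) power of the finite symmetric group of [X].  Elements of
    a finitely generated subgroup depend, in every coordinate, only on the
    tuple of coordinates of the generators, so there are finitely many. *)
Lemma locfin_ker (Om : pred X) N :
  (forall k w, N k -> all Om w -> k w = w) ->
  (forall k w x, N k -> all Om w -> ~~ Om x -> section k (rcons w x) = 1) ->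
  locfin N.
Proof.
move=> NOm Nsec s sN.
pose n := size s; pose perm k : {ffun X -> X} := [ffun x => root_perm k x].
pose tup w : {ffun 'I_n -> {ffun X -> X}} :=
  [ffun i : 'I_n => perm (section (nth 1 s i) w)].
have fixs k : gen [set` s] k -> forall w, all Om w -> k w = w.
  move=> gk w Ow; elim: gk => {k} [k /= /sN Nk||g h _ gw _ hw|k _ kw] //.
  - exact: NOm.
  - by rewrite autM hw.
  - by rewrite -{1}kw autK.
have triv k : gen [set` s] k -> forall w x, all Om w -> ~~ Om x ->
    section k (rcons w x) = 1.
  have Npt k0 w x : gen [set` s] k0 -> all Om w -> ~~ Om x ->
      exists y, k0 (rcons w x) = rcons w y /\ ~~ Om y.
    move=> gk Ow Ox; rewrite -cats1 section_cat_eq fixs // aut1letter.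
    exists (root_perm (section k0 w) x); rewrite cats1; split=> //.
    apply: contra Ox => Oy.
    have : k0 (rcons w x) = k0 (rcons w (root_perm (section k0 w) x)).
      rewrite [RHS]fixs ?all_rcons ?Oy //.
      by rewrite -!cats1 section_cat_eq fixs // aut1letter.
    by move/aut_inj/rcons_inj => [->].
  move=> gk; elim: gk => {k} [k /= /sN Nk||g h gg IHg gh IHh|k gk IHk] w x Ow Ox.
  - exact: Nsec.
  - exact: section1.
  - have [y [hE Oy]] := Npt h w x gh Ow Ox.
    by rewrite sectionM hE IHg // IHh // mulg1.
  - have [y [kE Oy]] := Npt k^-1 w x (gen_inv gk) Ow Ox.
    have -> : rcons w x = k (rcons w y) by rewrite -kE autKV.
    by rewrite sectionV IHk // invg1.
have code k : gen [set` s] k ->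
    exists F : {ffun {ffun 'I_n -> {ffun X -> X}} -> {ffun X -> X}},
      forall w, all Om w -> perm (section k w) = F (tup w).
  move=> gk; elim: gk => {k} [k /= ks||g h gg [F FP] gh [F' FP']|k gk [F FP]].
  - have lt_kn : (index k s < n)%N by rewrite index_mem.
    exists [ffun t : {ffun 'I_n -> {ffun X -> X}} => t (Ordinal lt_kn)] => w _.
    by rewrite !ffunE /= nth_index.
  - exists [ffun=> perm 1] => w _; by rewrite section1 ffunE.
  - exists [ffun t => [ffun x => F t (F' t x)]] => w Ow.
    apply/ffunP => x; rewrite !ffunE sectionM fixs // root_permM -FP // -FP' //.
    by rewrite !ffunE.
  - exists [ffun t => [ffun x => if [pick y | F t y == x] is Some y then y else x]] => w Ow.
    apply/ffunP => x; rewrite !ffunE -FP //.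
    have kw : k^-1 w = w by apply: fixs => //; exact: gen_inv.
    have -> : section k^-1 w = (section k w)^-1.
      by rewrite -{1}(fixs k gk w Ow) sectionV.
    case: pickP => [y /eqP <-|no]; first by rewrite ffunE root_permK.
    have := no (root_perm (section k w)^-1 x).
    by rewrite ffunE root_permKV eqxx.
have codeE k : exists F : {ffun {ffun 'I_n -> {ffun X -> X}} -> {ffun X -> X}},
    gen [set` s] k -> forall w, all Om w -> perm (section k w) = F (tup w).
  have [/code[F FP]|nk] := pselect (gen [set` s] k); first by exists F.
  by exists [ffun=> perm 1] => /nk.
have [c cP] := choice codeE.
exists {ffun {ffun 'I_n -> {ffun X -> X}} -> {ffun X -> X}}, c.
move=> g h sg sh cgh; suff -> : g = h by rewrite /= mulVg.
apply: tree_aut_eq => u.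
(* After the longest prefix over Om, one more letter makes all sections trivial. *)
have [Ou|] := boolP (all Om u); first by rewrite !fixs.
elim/last_ind: u => // u x IHu; rewrite all_rcons negb_and => nOm.
have [Ou|nOu] := boolP (all Om u).
  rewrite Ou orbF in nOm; rewrite -cats1 !section_cat_eq (fixs g) // (fixs h) // !aut1letter.
  congr (_ ++ [:: _]).
  have := cP g sg u Ou; rewrite cgh -(cP h sh u Ou) => /ffunP/(_ x).
  by rewrite !ffunE.
have trivp k : gen [set` s] k -> section k u = 1.
  move=> gk; elim/last_ind: u nOu {IHu nOm} => // u y IHu.
  rewrite all_rcons negb_and.
  have [Ou|nOu _] := boolP (all Om u); last first.
    by rewrite -cats1 section_cat IHu // section1.
  by rewrite orbF => Oy; exact: triv.
by rewrite -cats1 !section_cat_eq !trivp // IHu.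
Qed.

End LocallyFiniteTree.

(** * A rigidity property of cyclic orders *)

Section RotationRigidity.
Variables (X : finType) (f f' : X -> X) (Om : pred X) (x x' : X).
Hypotheses (f_inj : injective f) (f'_inj : injective f').
Hypotheses (Omx : Om x) (Omx' : Om x').
Hypothesis Omf : forall z, Om z -> Om (f z).
Hypothesis Omf' : forall z, Om (f' z) = Om z.
Hypothesis Omcycle : forall z, Om z -> fconnect f (f x) z.
Hypotheses (fx : f x != x) (f'x' : f' x' != x').

Let y := f x.
Let a z := findex f y z.
Hypothesis shift : forall z1 z2, Om z1 -> Om z2 -> z1 != x' -> z2 != x' ->
  (a (f' z1) + a z2 = a (f' z2) + a z1)%N.

Let n := order f y.

(** In the coordinate [a], a shift by more than one would leave the interval of
    values of [a] at two letters at least, while only [x'] is exceptional; and a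
    shift by zero would fix [x'] as well. *)
Lemma rotation_rigidity :
  (x' = x /\ forall z, Om z -> f' z = f z) \/
  (x' = f x /\ forall z, Om z -> f' (f z) = z).
Proof.
have n0 : (0 < n)%N by exact: order_gt0.
have an z : Om z -> (a z < n)%N by move=> Oz; apply: findex_max; exact: Omcycle.
have aK z : Om z -> iter (a z) f y = z by move=> Oz; apply: iter_findex; exact: Omcycle.
have a_inj z1 z2 : Om z1 -> Om z2 -> a z1 = a z2 -> z1 = z2.
  by move=> O1 O2 a12; rewrite -(aK z1) // -(aK z2) // a12.
have iterx : iter n.-1 f y = x.
  by apply: f_inj; rewrite -iterS prednK // iter_order.
have Oy : Om y by exact: Omf.
have ax : a x = n.-1 by rewrite /a -{1}iterx findex_iter // prednK.
have ay : a y = 0%N by exact: findex0.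
have af z : Om z -> z != x -> a (f z) = (a z).+1.
  move=> Oz zx; have ltz : ((a z).+1 < n)%N.
    rewrite ltn_neqAle an // andbT; apply: contra zx => /eqP E.
    by rewrite -(aK z) // -iterx -E.
  by rewrite /a -{1}(aK z) // -iterS findex_iter.
have n1 : (1 < n)%N.
  rewrite ltnNge; apply: contra fx => n1; apply/eqP; apply: a_inj => //.
  by rewrite ay ax; clear -n1 n0; lia.
have surj z : Om z -> exists2 w, Om w & f' w = z.
  move=> Oz; exists (iter (order f' z).-1 f' z).
    have E : f' (iter (order f' z).-1 f' z) = z.
      by rewrite -iterS prednK ?order_gt0 // iter_order.
    by rewrite -Omf' E.
  by rewrite -iterS prednK ?order_gt0 // iter_order.
have Of' z : Om z -> Om (f' z) by rewrite Omf'.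
have yx : y != x by [].
(* a point other than x' fixes the value of the shift *)
have [z0 [Oz0 z0x']] : exists z0, Om z0 /\ z0 != x'.
  have [xx'|xx'] := eqVneq x x'; last by exists x.
  by exists y; rewrite -xx'.
have [lt|gt|eq] := ltngtP (a z0) (a (f' z0)).
- left; have xx' : x' = x.
    apply/eqP; rewrite eq_sym; apply: contraT => xx'.
    have := shift Omx Oz0 xx' z0x'; have := an _ (Of' _ Omx).
    by rewrite ax; clear -lt n0; lia.
  (* the penultimate point bounds the shift by one *)
  have d1 : a (f' z0) = (a z0).+1.
    pose w := iter n.-2 f y.
    have lt2n : (n.-2 < n)%N by lia.
    have aw : a w = n.-2 by rewrite /a findex_iter.
    have Ow : Om w by rewrite /w; elim: (n.-2) => //= k; exact: Omf.
    have wx : w != x' by apply/eqP => wx; have := ax; rewrite -xx' -wx aw; clear -n1; lia.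
    have := shift Ow Oz0 wx z0x'; have := an _ (Of' _ Ow); rewrite aw; clear -lt n1; lia.
  have f'f z : Om z -> z != x -> f' z = f z.
    move=> Oz zx; apply: a_inj; [exact: Of' | exact: Omf |].
    rewrite af //; have zx' : z != x' by rewrite xx'.
    by have := shift Oz Oz0 zx' z0x'; clear -d1; lia.
  split=> // z Oz; have [->|] := eqVneq z x; last exact: f'f.
  have [w Ow wy] := surj y Oy; have [wx|wx] := eqVneq w x; first by rewrite -{1}wx.
  by have := af w Ow wx; rewrite -f'f // wy ay.
- right; have xy : x' = y.
    apply/eqP; rewrite eq_sym; apply: contraT => yx'.
    by have := shift Oy Oz0 yx' z0x'; rewrite ay; clear -gt; lia.
  have d1 : a z0 = (a (f' z0)).+1.
    have afy : a (f y) = 1%N by rewrite af // ay.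
    have Ofy : Om (f y) by exact: Omf.
    have wx : f y != x' by apply/eqP => wx; have := afy; rewrite wx xy ay.
    by have := shift Ofy Oz0 wx z0x'; rewrite afy; clear -gt; lia.
  split=> // z Oz.
  have f'f w : Om w -> w != y -> (a (f' w)).+1 = a w.
    move=> Ow wy; have wx' : w != x' by rewrite xy.
    by have := shift Ow Oz0 wx' z0x'; clear -d1; lia.
  have [->|zx] := eqVneq z x.
    have [w Ow wx] := surj x Omx; have [wy|wy] := eqVneq w y; first by rewrite -[RHS]wx wy.
    by have := f'f w Ow wy; rewrite wx ax => E; have := an w Ow; rewrite -E; clear -n0; lia.
  have fzy : f z != y by apply: contra zx => /eqP/f_inj ->.
  apply: a_inj => //; first by apply/Of'/Omf.
  by apply: succn_inj; rewrite f'f //; [exact: af | exact: Omf].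
- have fixed z : Om z -> z != x' -> f' z = z.
    move=> Oz zx'; apply: a_inj => //; first exact: Of'.
    by have := shift Oz Oz0 zx' z0x'; clear -eq; lia.
  by case/eqP: f'x'; apply: f'_inj; apply: fixed => //; exact: Of'.
Qed.

End RotationRigidity.

(** * Groups generated by directed automorphisms *)

Section Directed.
Variable X : finType.
Local Notation T := (tree_aut X).
Implicit Types (K M : set T) (g h k p q : T) (x y z : X) (w : seq X).

(** A nontrivial generator whose sections are not all trivial.  The third clause is
    balance, for the period of [x]; the last excludes the period one. *)
Definition directed g x :=
  [/\ g @ x = g, forall y, y != x -> g @ y = 1,
      forall y, iter (order (root_perm g) x) (root_perm g) y = y
    & root_perm g x != x].

Definition period g x := order (root_perm g) x.

Lemma period_gt0 g x : (0 < period g x)%N.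
Proof. exact: order_gt0. Qed.

Lemma root_perm_return g x : root_perm (g ^+ (period g x).-1) (root_perm g x) = x.
Proof.
rewrite root_permX -iterSr prednK ?period_gt0 // iter_order //.
exact: root_perm_inj.
Qed.

(** Walking around the orbit of [x] backwards avoids the only letter with a
    nontrivial section. *)
Lemma section_return g x : directed g x ->
  (g ^+ (period g x).-1) @ root_perm g x = 1.
Proof.
move=> [_ triv _ _]; apply: section_power_trivial => i lt_i; apply: triv.
rewrite -iterSr; apply/negP => /eqP E.
have := @findex_iter _ (root_perm g) x i.+1; rewrite E findex0.
have -> : (i.+1 < order (root_perm g) x)%N by move: lt_i; rewrite /period; lia.
by move=> /(_ isT).
Qed.

Lemma directed_period_section g x : directed g x -> (g ^+ period g x) @ x = g.
Proof.
move=> dg; have [gx _ _ _] := dg.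
by rewrite -(prednK (period_gt0 g x)) expgSr lsectionM section_return // mul1g.
Qed.

Lemma directed_period_fixes g x : directed g x -> fixes_letters (g ^+ period g x).
Proof. by case=> _ _ fg _ y; rewrite root_permX. Qed.

Lemma directed_section_off g x z n : directed g x ->
  ~~ fconnect (root_perm g) x z -> (g ^+ n) @ z = 1.
Proof.
move=> [_ triv _ _] nxz; apply: section_power_trivial => i _; apply: triv.
apply: contra nxz => /eqP <-.
rewrite fconnect_sym; [exact: fconnect_iter | exact: root_perm_inj].
Qed.

Lemma period_gt1 g x : directed g x -> (1 < period g x)%N.
Proof.
case=> _ _ _; apply: contraR; rewrite -leqNgt => le1.
have E : period g x = 1%N by have := period_gt0 g x; lia.
by have := iter_order (@root_perm_inj _ g) x; rewrite -/(period g x) E => /= /eqP.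
Qed.

(** [g ^+ (period g x)] has section [g] at [x]: an exponent of [g] would descend
    forever. *)
Lemma directed_torsion_free g x n : directed g x -> (0 < n)%N -> g ^+ n <> 1.
Proof.
move=> dg; have n1 := period_gt1 dg.
elim/ltn_ind: n => n IHn n0 gn1.
have iterf : iter n (root_perm g) x = x by rewrite -root_permX gn1 root_perm1.
have dvd : (period g x %| n)%N.
  rewrite /dvdn; apply/eqP; set r := (n %% _)%N.
  have lt_r : (r < period g x)%N by rewrite ltn_mod period_gt0.
  have iter_mul m : iter (m * period g x) (root_perm g) x = x.
    elim: m => // m IHm; rewrite mulSn iterD IHm.
    exact/iter_order/root_perm_inj.
  have : iter r (root_perm g) x = x.
    by rewrite -{1}(iter_mul (n %/ period g x)%N) -iterD addnC -divn_eq.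
  by move=> E; have := findex_iter lt_r; rewrite E findex0.
have [m nE] := dvdnP dvd.
have gm1 : g ^+ m = 1.
  have : ((g ^+ period g x) ^+ m) @ x = 1.
    by rewrite -expgnA mulnC -nE gn1 section1.
  by rewrite section_fixedX ?directed_period_section //; exact: directed_period_fixes.
by apply: (IHn m) => //; nia.
Qed.

Variable Y : seq (T * X).
Hypothesis Ydir : forall g x, (g, x) \in Y -> directed g x.

Definition gens (Z : seq (T * X)) : set T := [set g | exists x, (g, x) \in Z].
Definition grp Z := gen (gens Z).

Let H := grp Y.

Lemma grp_subgroup Z : is_subgroup (grp Z).
Proof. exact: gen_subgroup. Qed.

Lemma mem_grp Z g x : (g, x) \in Z -> grp Z g.
Proof. by move=> gx; apply: gen_in; exists x. Qed.

(** A generator [(g, x)] contributes to sections only through its active letter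
    [x], so sections along an invariant set of letters involve only the
    generators active there. *)
Lemma grp_section (P : pred X) :
  (forall h z, H h -> P (root_perm h z) = P z) ->
  forall h z, H h -> P z -> grp [seq p <- Y | P p.2] (h @ z).
Proof.
move=> Pinv h z Hh; elim: Hh z => {h} [g [x gx]||g h Hg IHg Hh IHh|h Hh IHh] z Pz.
- have [g_x triv _ _] := Ydir gx.
  have [zx|zx] := eqVneq z x; last by rewrite triv //; exact: gen_one.
  by rewrite zx g_x; apply: (@mem_grp _ _ x); rewrite mem_filter gx /= -zx Pz.
- by rewrite section1; exact: gen_one.
- rewrite lsectionM; apply: gen_mul; last exact: IHh.
  by apply: IHg; rewrite Pinv.
- have -> : z = root_perm h (root_perm h^-1 z) by rewrite root_permKV.
  rewrite lsectionV; apply: gen_inv; apply: IHh.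
  by rewrite Pinv //; exact: gen_inv.
Qed.

Lemma section_closed h z : H h -> H (h @ z).
Proof.
move=> Hh; have := @grp_section xpredT (fun _ _ _ => erefl) h z Hh isT.
by rewrite filter_predT.
Qed.

(** Transport without twisting, by which a section realized at one letter is
    realized unchanged at another. *)
Definition linked z z' := exists p, [/\ H p, root_perm p z = z' & p @ z = 1].

Lemma linked_refl z : linked z z.
Proof. by exists 1; split; [exact: gen_one | exact: root_perm1 | exact: section1]. Qed.

Lemma linked_sym z z' : linked z z' -> linked z' z.
Proof.
move=> [p [Hp <- pz]]; exists p^-1; split; first exact: gen_inv.
  exact: root_permK.
by rewrite lsectionV pz invg1.
Qed.

Lemma linked_trans z1 z2 z3 : linked z1 z2 -> linked z2 z3 -> linked z1 z3.
Proof.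
move=> [p [Hp <- pz]] [q [Hq <- qz]]; exists (q * p); split; first exact: gen_mul.
  exact: root_permM.
by rewrite lsectionM qz pz mulg1.
Qed.

(** Orbits are linked: the one edge with a nontrivial section can be bypassed
    by going around the orbit the other way. *)
Lemma linked_orbit h z : H h -> linked z (root_perm h z).
Proof.
move=> Hh; elim: Hh z => {h} [g [x gx]||g h Hg IHg Hh IHh|h Hh IHh] z.
- have [zx|zx] := eqVneq z x.
    rewrite zx; apply: linked_sym; exists (g ^+ (period g x).-1); split.
    + by apply: subgroupX; [exact: grp_subgroup | exact: mem_grp gx].
    + exact: root_perm_return.
    + exact: section_return (Ydir gx).
  exists g; split=> //; first exact: mem_grp gx.
  by have [_ triv _ _] := Ydir gx; exact: triv.
- exact: linked_refl.
- by rewrite root_permM; exact: linked_trans (IHh z) (IHg _).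
- by apply: linked_sym; rewrite -{2}(root_permKV h z).
Qed.

Definition orbit_of o : pred X := fun z => `[< linked o z >].

Lemma orbit_ofP o z : reflect (linked o z) (orbit_of o z).
Proof. exact: asboolP. Qed.

Lemma orbit_of_inv o h z : H h -> orbit_of o (root_perm h z) = orbit_of o z.
Proof.
move=> Hh; apply/orbit_ofP/orbit_ofP => oz.
  exact: linked_trans oz (linked_sym (linked_orbit z Hh)).
exact: linked_trans oz (linked_orbit z Hh).
Qed.

Lemma orbit_section o h : H h ->
  grp [seq p <- Y | orbit_of o p.2] (h @ o).
Proof.
move=> Hh; apply: grp_section => //; first by move=> k z; exact: orbit_of_inv.
by apply/orbit_ofP; exact: linked_refl.
Qed.

(** ** The transitive case *)

Variable o : X.
Let Om := orbit_of o.
Hypothesis Ytrans : forall g x, (g, x) \in Y -> Om x.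

Lemma Om_linked z z' : Om z -> Om z' -> linked z z'.
Proof. by move=> /orbit_ofP oz /orbit_ofP; apply: linked_trans; exact: linked_sym. Qed.

Lemma Om_root_perm h z : H h -> Om (root_perm h z) = Om z.
Proof. exact: orbit_of_inv. Qed.

Lemma section_off_Om h z : H h -> ~~ Om z -> h @ z = 1.
Proof.
move=> Hh nOz; have := @grp_section (predC Om) _ h z Hh nOz.
have -> : [seq p <- Y | predC Om p.2] = [::].
  by apply/eqP; rewrite -[_ == _]negbK -has_filter; apply/hasPn => -[g x] /Ytrans /= ->.
move=> /(_ (fun h z Hh => congr1 negb (Om_root_perm z Hh))).
apply: (@gen_min _ _ [set 1]) => [|g [x] //].
by split=> [//|x y -> ->|x ->] /=; rewrite ?mulg1 ?invg1.
Qed.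

Lemma Om_word h w : H h -> all Om w -> all Om (h w).
Proof.
elim: w h => [|x w IHw] h Hh; first by rewrite aut_nil.
rewrite aut_cons => /andP[Ox Ow]; apply/andP; split; first by rewrite Om_root_perm.
exact: (IHw _ (section_closed x Hh) Ow).
Qed.

(** The element [g ^+ period g x] fixes all letters and has section [g] at [x];
    conjugating it by an untwisted transport moves this section to [z].  The
    subgroup [L] keeps track of where the lifts can be found. *)
Lemma section_onto (L : set T) z : Om z -> is_subgroup L ->
  normalized_by H L ->
  (forall g x, (g, x) \in Y -> L (g ^+ period g x)) ->
  forall h, H h -> exists s, [/\ H s, L s, fixes_letters s & s @ z = h].
Proof.
move=> Oz [L1 LM LV] nL LY h; elim=> {h} [g [x gx]||g h _ [s [Hs Ls fs sz]] _
   [t [Ht Lt ft tz]]|h _ [s [Hs Ls fs sz]]].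
- have dg := Ydir gx; have [p [Hp px p1]] := Om_linked (Ytrans gx) Oz.
  have Hgn : H (g ^+ period g x).
    by apply: subgroupX; [exact: grp_subgroup | exact: mem_grp gx].
  have fgn := directed_period_fixes dg.
  exists (p * g ^+ period g x * p^-1); split.
  + by apply: gen_mul; [exact: gen_mul | exact: gen_inv].
  + by apply: nL => //; exact: LY gx.
  + by move=> u; rewrite -{1}(root_permKV p u) root_perm_conj // root_permKV.
  + by rewrite -px section_conj // directed_period_section // p1 invg1 mulg1 mul1g.
- exists 1; split=> //; [exact: gen_one | exact: section1].
- exists (s * t); split; [exact: gen_mul | exact: LM | exact: fixes_lettersM |].
  by rewrite lsectionM ft sz tz.
- exists s^-1; split; [exact: gen_inv | exact: LV | exact: fixes_lettersV |].
  by rewrite section_fixedV // sz.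
Qed.

(** Elements that cannot be seen by a homomorphism whose values are determined by
    the section at any single letter of [Om]. *)
Definition untwisted : set T :=
  [set q | H q /\ exists z, [/\ Om z, root_perm q z = z & q @ z = 1]].
Let R := gen untwisted.

Lemma untwisted_grp q : R q -> H q.
Proof. by apply: gen_min => [|{}q []] //; exact: grp_subgroup. Qed.

Lemma untwisted_normal : normalized_by H R.
Proof.
apply: gen_normalized; first exact: grp_subgroup.
move=> h q Hh [Hq [z [Oz qz q1]]]; split.
  by apply: gen_mul; [exact: gen_mul | exact: gen_inv].
exists (root_perm h z); split; first by rewrite Om_root_perm.
  exact: root_perm_conj.
by rewrite section_conj // q1 mulg1 mulgV.
Qed.

(** If no generator cycles through all of [Om], each [g ^+ period g x] has trivial
    section at a letter off the orbit of [x], so every section is realized by a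
    product of untwisted elements; what remains has trivial section at [o]. *)
Lemma untwisted_level1 :
  (forall g x, (g, x) \in Y -> exists2 z, Om z & ~~ fconnect (root_perm g) x z) ->
  forall s, H s -> fixes_letters s -> R s.
Proof.
move=> off s Hs fs.
have Oo : Om o by apply/orbit_ofP; exact: linked_refl.
have sR := gen_subgroup untwisted.
have [|t [Ht Rt ft to]] := section_onto Oo sR untwisted_normal _ (section_closed o Hs).
  move=> g x gx; have [z Oz nz] := off g x gx; have dg := Ydir gx.
  apply: gen_in; split.
    by apply: subgroupX; [exact: grp_subgroup | exact: mem_grp gx].
  exists z; split=> //; first exact: directed_period_fixes.
  exact: directed_section_off nz.
rewrite -(mulVKg t s); apply: gen_mul => //; apply: gen_in; split.
  by apply: gen_mul => //; exact: gen_inv.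
exists o; split=> //; first by rewrite root_permM fs -{1}(ft o) root_permK.
by rewrite lsectionM fs section_fixedV // to mulVg.
Qed.

End Directed.

(** * Abelian action on the active subtree *)

Section Rigidity.
Variable X : finType.
Local Notation T := (tree_aut X).
Implicit Types (g h k p q m : T) (x y z : X) (w : seq X).

Variable Y : seq (T * X).
Hypothesis Ydir : forall g x, (g, x) \in Y -> directed g x.
Variable o : X.
Let H := grp Y.
Let Om := orbit_of Y o.
Let R := gen (untwisted Y o).
Hypothesis Ytrans : forall g x, (g, x) \in Y -> Om x.

Let sH : is_subgroup H := grp_subgroup Y.
Let sR : is_subgroup R := gen_subgroup _.
Let nR : normalized_by H R := @untwisted_normal _ Y Ydir o.

Let OmE h z : H h -> Om (root_perm h z) = Om z.
Proof. by move=> Hh; exact: Om_root_perm. Qed.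

Lemma mem_gen_grp g x n : (g, x) \in Y -> H (g ^+ n).
Proof. by move=> gx; apply: subgroupX => //; exact: mem_grp gx. Qed.

Section Homomorphism.
Variables (M : set T) (mu : T -> int).
Hypotheses (sM : is_subgroup M) (MH : forall m, M m -> H m).
Hypotheses (nM : normalized_by H M) (fM : finite_index_in M H).
Hypothesis muM : additive_on M mu.
Hypothesis mu_untwisted : forall m z,
  M m -> Om z -> root_perm m z = z -> m @ z = 1 -> mu m = 0%R.

(** Generators [a] of [untwisted] centralize [M] modulo the kernel of [mu], since
    [a] commutes at a letter [z] with a power of any element of [M]; their own
    powers are in the kernel.  So the transfer of [mu] vanishes. *)
Lemma mu_vanishes m : R m -> M m -> mu m = 0%R.
Proof.
have RH := @untwisted_grp _ Y o.
apply: transfer_vanishing => //.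
- by apply: fin_index_restrict fM; exact: RH.
- by move=> h k /RH Hh; exact: nM.
- move=> a k [Ha [z [Oz az a1]]] Mk.
  have [n n0 /(_ z) kz] := exp_fixes_letters k.
  have Mkn : M (k ^+ n) by exact: subgroupX.
  have Mak : M (a * k * a^-1) by exact: nM.
  have Makn : M (a * k ^+ n * a^-1) by exact: nM.
  have aX : a * k ^+ n * a^-1 = (a * k * a^-1) ^+ n.
    have := conjXg k a^-1 n; rewrite !conjgE !invgK !mulgA.
    by [].
  have E : mu (a * k ^+ n * a^-1) = mu (k ^+ n).
    have [_ MM MV] := sM.
    have : mu (a * k ^+ n * a^-1 * (k ^+ n)^-1) = 0%R.
      apply: (mu_untwisted _ Oz); first by apply: MM => //; exact: MV.
        by rewrite root_permM -{1}kz root_permK -{1}az root_perm_conj.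
      rewrite lsectionM -{1}kz root_permK section_fixedV //.
      by rewrite -{1}az section_conj // a1 invg1 mulg1 mul1g mulgV.
    rewrite muM //; last exact: MV.
    by rewrite (additiveV sM muM) //; lia.
  have := E; rewrite aX !(additiveX _ sM muM) //.
  exact: pmulrnI.
- move=> a n [Ha [z [Oz az a1]]] Man.
  apply: (mu_untwisted Man Oz); last by rewrite section_fixedX // a1 expg1n.
  by rewrite root_permX; elim: n {Man} => //= n ->.
Qed.

Hypothesis mu_nonzero : exists2 m, M m & mu m <> 0%R.

(** Otherwise [mu] would vanish, its values having a vanishing multiple. *)
Lemma exponent_not_untwisted e : (0 < e)%N ->
  ~ forall m, M m -> R (m ^+ e).
Proof.
move=> e0 MR; have [m Mm []] := mu_nonzero.
have := mu_vanishes (MR m Mm) (subgroupX e sM Mm).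
rewrite (additiveX _ sM muM) // => /eqP; rewrite mulrn_eq0 => /orP[|/eqP //]; lia.
Qed.

(** Otherwise the untwisted subgroup contains a power of every element of [M],
    which kills [mu]. *)
Lemma exists_full_cycle : exists g x, (g, x) \in Y /\
  forall z, Om z -> fconnect (root_perm g) x z.
Proof.
apply: contrapT => nfull; have off g x : (g, x) \in Y ->
    exists2 z, Om z & ~~ fconnect (root_perm g) x z.
  move=> gx; apply: contrapT => noz; apply: nfull; exists g, x; split=> // z Oz.
  by apply: contrapT => /negP nz; apply: noz; exists z.
have L1 := untwisted_level1 Ydir Ytrans off.
have [m Mm mm] := mu_nonzero.
have [n n0 fn] := exp_fixes_letters m.
have Rmn : R (m ^+ n) by apply: L1 => //; apply: subgroupX => //; exact: MH.
apply: mm; have := mu_vanishes Rmn (subgroupX n sM Mm).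
rewrite (additiveX _ sM muM) // => /eqP; rewrite mulrn_eq0 => /orP[|/eqP //]; lia.
Qed.

Section FullCycle.
Variables (g : T) (x : X).
Hypothesis gx : (g, x) \in Y.
Hypothesis full : forall z, Om z -> fconnect (root_perm g) x z.

Let f := root_perm g.
Let y := f x.
Let a z := findex f y z.

Let f_inj : injective f := @root_perm_inj _ g.

Lemma full_from_next z : Om z -> fconnect f y z.
Proof. by move=> /full; rewrite -(same_fconnect1 f_inj). Qed.

(** The walk from [y] to [z] along the cycle of [g] stops before the edge leaving
    the active letter [x], which closes the cycle. *)
Lemma full_step z : Om z -> root_perm (g ^+ a z) y = z /\ (g ^+ a z) @ y = 1.
Proof.
move=> Oz; have yz := full_from_next Oz.
have zE : iter (a z) f y = z by exact: iter_findex.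
split; first by rewrite root_permX.
have [_ triv _ _] := Ydir gx; apply: section_power_trivial => i lt_i; apply: triv.
apply/eqP => ix; have := findex_max yz; rewrite -/(a z) => lt_az.
have zk : iter (a z - i.+1) f y = z.
  by rewrite -[RHS]zE -[in RHS](subnK lt_i) iterD iterS -/f ix.
have : a z = (a z - i.+1)%N.
  rewrite {1}/a -{1}zk findex_iter //; apply: leq_ltn_trans lt_az; exact: leq_subr.
by lia.
Qed.

(** Both [g'] and a power of [g] carry the subtree at [z] to the subtree at
    [root_perm g' z] without twisting it. *)
Lemma generator_shift g' x' z : (g', x') \in Y -> Om z -> z != x' ->
  R ((g ^+ a (root_perm g' z))^-1 * g' * g ^+ a z).
Proof.
move=> gx' Oz zx'; have Hg' := mem_grp gx'.
have Oz' : Om (root_perm g' z) by rewrite OmE.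
have [az a1] := full_step Oz; have [az' a1'] := full_step Oz'.
have [_ triv' _ _] := Ydir gx'.
apply: gen_in; split.
  by apply: gen_mul; [apply: gen_mul => //; apply: gen_inv|]; exact: mem_gen_grp gx.
have E : root_perm (g ^+ a (root_perm g' z))^-1 (root_perm g' z) = y.
  by rewrite -{2}az' root_permK.
exists y; split.
- have Oy : Om y by rewrite /y /f OmE ?(Ytrans gx) //; exact: mem_grp gx.
  exact: Oy.
- by rewrite !root_permM az.
- rewrite lsectionM az a1 mulg1 lsectionM triv' // mulg1 -{2}az'.
  by rewrite lsectionV a1' invg1.
Qed.

(** By [generator_shift], every generator is congruent to a quotient of powers of
    [g], so [g] generates the quotient by the untwisted subgroup. *)
Lemma power_coset h : H h -> exists i j, R ((g ^+ i)^-1 * h * g ^+ j).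
Proof.
have nRg r n : R r -> R ((g ^+ n)^-1 * r * g ^+ n).
  move=> Rr; rewrite -{2}(invgK (g ^+ n)); apply: nR => //.
  by apply: gen_inv; exact: mem_gen_grp gx.
elim=> {h} [h [z hz]||h k _ [i [j Rij]] _ [i' [j' Rij']]|h _ [i [j Rij]]].
- have [_ _ _ hz'] := Ydir hz.
  exists (a (root_perm h (root_perm h z))), (a (root_perm h z)).
  apply: (generator_shift hz) => //; rewrite OmE ?(Ytrans hz) //.
  exact: mem_grp hz.
- by exists 0%N, 0%N; rewrite expg0 invg1 !mulg1; exact: gen_one.
- by exists (i + i')%N, (j + j')%N; exact: power_cosetM.
- by exists j, i; have := gen_inv Rij; rewrite !invgM invgK mulgA.
Qed.

(** The generator [g] has infinite order in this cyclic quotient, which would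
    otherwise have finite exponent. *)
Lemma power_not_untwisted e : (0 < e)%N -> ~ R (g ^+ e).
Proof.
move=> e0 Re; apply: (exponent_not_untwisted e0) => m Mm.
have [i [j Rij]] := power_coset (MH Mm).
have Hg n : H (g ^+ n) by exact: mem_gen_grp gx.
have HV n : H (g ^+ n)^-1 by apply: gen_inv; exact: Hg.
have Rm : R ((g ^+ i * (g ^+ j)^-1)^-1 * m).
  have -> : (g ^+ i * (g ^+ j)^-1)^-1 * m =
      g ^+ j * ((g ^+ i)^-1 * m * g ^+ j) * (g ^+ j)^-1.
    by rewrite invgM invgK !mulgA mulgK.
  exact: nR.
have := cosetX e sH sR nR _ Rm; move=> /(_ (gen_mul (Hg i) (HV j))).
apply: (subgroup_mulL sR); apply: gen_inv.
rewrite expgnFl; last by apply: commuteX2; exact: commute_refl.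
rewrite -!expgnA ![(_ * e)%N]mulnC !expgnA.
by apply: gen_mul; [|apply: gen_inv]; exact: subgroupX.
Qed.

Lemma power_inj i j : R ((g ^+ i)^-1 * g ^+ j) -> i = j.
Proof.
move=> Rij; case: (ltngtP i j) => // lt.
  case: (@power_not_untwisted (j - i)); first by rewrite subn_gt0.
  by move: Rij; rewrite -{1}(subnKC (ltnW lt)) expgnDr mulKg.
case: (@power_not_untwisted (i - j)); first by rewrite subn_gt0.
move: (gen_inv Rij); rewrite invgM invgK.
by rewrite -{1}(subnKC (ltnW lt)) expgnDr mulKg.
Qed.

(** Comparing [generator_shift] at two letters gives an equality of exponents of
    [g], since [g] has infinite order modulo the untwisted subgroup. *)
Lemma generator_rotation g' x' : (g', x') \in Y ->
  let f' := root_perm g' in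
  (x' = x /\ forall z, Om z -> f' z = f z) \/
  (x' = f x /\ forall z, Om z -> f' (f z) = z).
Proof.
move=> gx' f'; have Hg' := mem_grp gx'; have Hg := mem_grp gx.
have [_ _ _ fx] := Ydir gx; have [_ _ _ fx'] := Ydir gx'.
apply: rotation_rigidity => //.
- exact: root_perm_inj.
- exact: Ytrans gx.
- exact: Ytrans gx'.
- by move=> z; rewrite OmE.
- by move=> z; rewrite OmE.
- exact: full_from_next.
move=> z1 z2 O1 O2 zx1 zx2.
have R1 := gen_inv (generator_shift gx' O1 zx1).
have R2 := generator_shift gx' O2 zx2.
rewrite !invgM invgK mulgA in R1.
have nRg r n : R r -> R ((g ^+ n)^-1 * r * g ^+ n).
  move=> Rr; rewrite -{2}(invgK (g ^+ n)); apply: nR => //.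
  by apply: gen_inv; exact: mem_gen_grp gx.
have := power_cosetM sR nRg R1 R2; rewrite mulVg mulg1 => /power_inj.
by rewrite /a /f' -/y -/f; lia.
Qed.

(** On words over [Om], each of [g], [g'] and [g^-1] is determined by its rotation of
    [Om] and its active letter, through the same recursion; the active letter of
    [g^-1] is [f x]. *)
Lemma generator_power g' x' : (g', x') \in Y ->
  (forall w, all Om w -> g' w = g w) \/ (forall w, all Om w -> g' w = g^-1 w).
Proof.
move=> gx'; have Hg := mem_grp gx.
have [g_x triv _ _] := Ydir gx; have [g'_x triv' _ _] := Ydir gx'.
case: (generator_rotation gx') => [[xx' f'f]|[xx' f'f]]; [left | right].
  elim=> [|z w IHw]; first by rewrite !aut_nil.
  move=> /andP[Oz Ow]; rewrite !aut_cons f'f //; congr (_ :: _).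
  have [->|zx] := eqVneq z x; first by rewrite g_x -{1}xx' g'_x IHw.
  by rewrite triv // triv' // xx'.
suff gK w : all Om w -> g' (g w) = w.
  move=> w Ow; rewrite -{1}(autKV g w) gK //.
  by apply: (Om_word Ydir) => //; exact: gen_inv.
elim: w => [|z w IHw]; first by rewrite !aut_nil.
move=> /andP[Oz Ow]; rewrite !aut_cons f'f //; congr (_ :: _).
have [->|zx] := eqVneq z x; first by rewrite g_x -/f -xx' g'_x IHw.
rewrite triv // triv' // xx'; apply: contra zx => /eqP/f_inj ->.
by [].
Qed.

End FullCycle.

Definition commute_on (Om : pred X) h k := forall w, all Om w -> h (k w) = k (h w).

Lemma commute_on_gens k : H k ->
  (forall g x, (g, x) \in Y -> commute_on Om g k) ->
  forall h, H h -> commute_on Om h k.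
Proof.
move=> Hk gk h; elim=> {h} [g [x gx]||g h Hg IHg Hh IHh|h Hh IHh] w Ow.
- exact: gk gx w Ow.
- by [].
- by rewrite !autM IHh // IHg //; exact: (Om_word Ydir).
- apply: (@aut_inj _ h); rewrite autKV IHh ?autKV //.
  by apply: (Om_word Ydir) => //; exact: gen_inv.
Qed.

Theorem commute_of_homomorphism h k : H h -> H k -> commute_on Om h k.
Proof.
move=> Hh Hk; have [g [x [gx full]]] := exists_full_cycle.
have Hg := mem_grp gx.
have gP := generator_power gx full.
have Ow' j w : H j -> all Om w -> all Om (j w) by exact: (Om_word Ydir).
have HgV : H g^-1 by exact: gen_inv.
apply: commute_on_gens => // g1 x1 gx1 w Ow; symmetry; move: w Ow.
apply: commute_on_gens => //; first exact: mem_grp gx1.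
move=> g2 x2 gx2 w Ow.
have [Hg1 Hg2] := (mem_grp gx1, mem_grp gx2).
case: (gP _ _ gx1) => E1; case: (gP _ _ gx2) => E2;
  by rewrite (E2 (g1 w)) ?Ow' // (E1 w) // (E1 (g2 w)) ?Ow' // (E2 w) // ?autK ?autKV.
Qed.

End Homomorphism.

End Rigidity.

(** * Elementary amenable transitive groups *)

Section Large.
Variable X : finType.
Local Notation T := (tree_aut X).
Implicit Types (K M N : set T) (g h k m : T) (x z : X) (u v w : seq X).

Lemma section_fixM g h v : h v = v -> section (g * h) v = section g v * section h v.
Proof. by move=> hv; rewrite sectionM hv. Qed.

Lemma section_fixV g v : g v = v -> section g^-1 v = (section g v)^-1.
Proof. by move=> gv; rewrite -{1}gv sectionV. Qed.

Lemma autV_fix g v : g v = v -> g^-1 v = v.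
Proof. by move=> gv; rewrite -{1}gv autK. Qed.

Definition sections_at K v : set T :=
  [set m | exists k, [/\ K k, k v = v & section k v = m]].

Lemma sections_at_subgroup K v : is_subgroup K -> is_subgroup (sections_at K v).
Proof.
move=> [K1 KM KV]; split=> [|_ _ [k [Kk kv <-]] [h [Kh hv <-]]|_ [k [Kk kv <-]]].
- by exists 1; rewrite section1.
- by exists (k * h); rewrite autM hv section_fixM //; split=> //; exact: KM.
- by exists k^-1; rewrite autV_fix // section_fixV //; split=> //; exact: KV.
Qed.

Lemma sections_at_sub K K' v : (forall k, K k -> K' k) ->
  forall m, sections_at K v m -> sections_at K' v m.
Proof. by move=> KK' m [k [Kk kv km]]; exists k; split=> //; exact: KK'. Qed.

Lemma section_choice K v M : (forall m, M m -> sections_at K v m) ->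
  exists c : T -> T, forall m, M m -> [/\ K (c m), c m v = v & section (c m) v = m].
Proof.
move=> MK; have ex m : exists k, M m -> [/\ K k, k v = v & section k v = m].
  have [/MK[k kP]|nM] := pselect (M m); first by exists k.
  by exists 1 => /nM.
by have [c cP] := choice ex; exists c.
Qed.

Lemma section_quot k h v : k v = v -> h v = v ->
  (k^-1 * h) v = v /\ section (k^-1 * h) v = (section k v)^-1 * section h v.
Proof.
move=> kv hv; rewrite autM hv autV_fix //; split=> //.
by rewrite section_fixM // section_fixV.
Qed.

(** Colour a section by the colour of a chosen lift. *)
Lemma fin_index_sections K N M v : is_subgroup M -> finite_index_in N K ->
  (forall m, M m -> sections_at K v m) ->
  finite_index_in [set m | M m /\ sections_at N v m] M.
Proof.
move=> [_ MM MV] [I [c cN]] MK; have [l lP] := section_choice MK.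
exists I, (fun m => c (l m)) => m p Mm Mp cmp.
have [Km mv sm] := lP m Mm; have [Kp pv sp] := lP p Mp.
split; first by apply: MM => //; exact: MV.
have [qv sq] := section_quot mv pv.
by exists ((l m)^-1 * l p); split=> //; [exact: cN | rewrite sq sm sp].
Qed.

(** Powers of [k0] change the value of [lam] on a lift by any multiple of
    [lam k0] without changing its section, so only the residue of that value
    obstructs finding a lift in the kernel. *)
Lemma fin_index_kernel_sections K M v (lam : T -> int) k0 :
  is_subgroup K -> is_subgroup M -> additive_on K lam ->
  (forall m, M m -> sections_at K v m) ->
  K k0 -> k0 v = v -> section k0 v = 1 -> lam k0 <> 0%R ->
  finite_index_in [set m | M m /\ sections_at [set k | K k /\ lam k = 0%R] v m] M.
Proof.
move=> sK [_ MM MV] lamM MK Kk0 k0v k01 lam0; have [l lP] := section_choice MK.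
have [K1 KM KV] := sK.
have twist (c : int) : exists k, [/\ K k, k v = v, section k v = 1
    & lam k = (c * lam k0)%R].
  have fixX k n : k v = v -> section k v = 1 ->
      (k ^+ n) v = v /\ section (k ^+ n) v = 1.
    move=> kv k1; elim: n => [|n [knv kn1]]; first by rewrite expg0 section1.
    by rewrite expgS autM knv kv section_fixM // k1 kn1 mulg1.
  case: c => n.
    exists (k0 ^+ n); have [k0nv k0n1] := fixX k0 n k0v k01.
    split=> //; first exact: subgroupX.
    by rewrite (additiveX _ sK lamM) // -mulr_natl natz.
  have kV1 : section k0^-1 v = 1 by rewrite section_fixV // k01 invg1.
  exists (k0^-1 ^+ n.+1); have [k0nv k0n1] := fixX k0^-1 n.+1 (autV_fix k0v) kV1.
  split=> //; first by apply: subgroupX => //; exact: KV.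
  rewrite (additiveX _ sK lamM) ?(additiveV sK lamM) //; last exact: KV.
  by rewrite -mulr_natl natz NegzE; lia.
pose d := `|lam k0|%N; have d0 : (0 < d)%N by rewrite /d; lia.
have lt_d (c : int) : (`|(c %% d)%Z|%N < d)%N.
  by have := @modz_ge0 c d; have := @ltz_pmod c d; lia.
exists 'I_d, (fun m => Ordinal (lt_d (lam (l m)))) => m p Mm Mp [cmp].
have [Km mv sm] := lP m Mm; have [Kp pv sp] := lP p Mp.
split; first by apply: MM => //; exact: MV.
have [c cE] : exists c : int, (lam (l p) - lam (l m) = c * lam k0)%R.
  have E1 := divz_eq (lam (l m)) d; have E2 := divz_eq (lam (l p)) d.
  have Emod : (lam (l m) %% d)%Z = (lam (l p) %% d)%Z.
    have := @modz_ge0 (lam (l m)) d; have := @modz_ge0 (lam (l p)) d; lia.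
  set q1 := (lam (l m) %/ d)%Z in E1; set q2 := (lam (l p) %/ d)%Z in E2.
  have [kd|kd] : (lam k0 = d :> int \/ lam k0 = - (d : int))%R by rewrite /d; lia.
    by exists (q2 - q1)%R; rewrite kd E1 E2 Emod mulrBl; lia.
  by exists (q1 - q2)%R; rewrite kd E1 E2 Emod mulrN mulrBl; lia.
have [k [Kk kv k1 lamk]] := twist (- c)%R.
have [qv sq] := section_quot mv pv.
have KVm : K (l m)^-1 by exact: KV.
exists (k * ((l m)^-1 * l p)); split.
- split; first by apply: (KM) => //; exact: KM.
  rewrite !lamM ?(additiveV sK lamM) //; last exact: KM.
  by rewrite lamk; lia.
- by rewrite autM qv kv.
- by rewrite section_fixM // k1 mul1g sq sm sp.
Qed.

Variable Y : seq (T * X).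
Hypothesis Ydir : forall g x, (g, x) \in Y -> directed g x.
Variable o : X.
Let H := grp Y.
Let Om := orbit_of Y o.
Hypothesis Ytrans : forall g x, (g, x) \in Y -> Om x.
Hypothesis Ynil : Y <> [::].

Let sH : is_subgroup H := grp_subgroup Y.

(** Largeness of a group in [chou] passes to one of the groups that it is built
    from, except across a cyclic extension from which [large_cyclic] extracts a
    homomorphism defined on sections. *)
Definition large K := exists u M,
  [/\ is_subgroup M, forall m, M m -> H m, finite_index_in M H
    & forall m, M m -> sections_at K u m].

Lemma large_sub K K' : (forall k, K k -> K' k) -> large K -> large K'.
Proof.
move=> KK' [u [M [sM MH fM MK]]]; exists u, M; split=> // m /MK.
exact: sections_at_sub.
Qed.

Lemma large_section_sub N v M : is_subgroup N -> is_subgroup M ->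
  (forall m, M m -> H m) -> finite_index_in M H ->
  finite_index_in [set m | M m /\ sections_at N v m] M -> large N.
Proof.
move=> sN sM MH fM fN; exists v, [set m | M m /\ sections_at N v m].
have [M1 MM MV] := sM; have [S1 SM SV] := sections_at_subgroup v sN.
split=> [|m [/MH]||m []] //; last exact: fin_index_trans fN.
split=> [|m p [Mm Sm] [Mp Sp]|m [Mm Sm]]; split=> //.
- exact: MM.
- exact: SM.
- exact: MV.
- exact: SV.
Qed.

(** [H] has elements of infinite order, so its finite-index subgroups are not
    trivial. *)
Lemma large_nontrivial K : large K -> ~ forall k, K k -> k = 1.
Proof.
move=> [u [M [sM MH fM MK]]] K1.
have [[g x] gx] : exists p, p \in Y by case: Y Ynil => // p s _; exists p; rewrite mem_head.
have [n n0 Mgn] := fin_index_power sH sM fM (mem_grp gx).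
have [k [/K1 -> _]] := MK _ Mgn; rewrite section1 => gn.
exact: directed_torsion_free (Ydir gx) n0 (esym gn).
Qed.

Lemma large_finite N K : is_subgroup N -> finite_index_in N K -> large K -> large N.
Proof.
move=> sN fN [u [M [sM MH fM MK]]].
apply: (large_section_sub sN sM MH fM (v := u)).
exact: fin_index_sections sM fN MK.
Qed.

(** Finite-index subgroups of [H] are finitely generated, hence so is some large
    subgroup of [K]. *)
Lemma large_local K : large K -> exists2 s : seq T,
  (forall k, k \in s -> K k) & large (gen [set` s]).
Proof.
move=> [u [M [sM MH fM MK]]].
have HE k : H k <-> gen [set` map fst Y] k.
  split; apply: gen_mono => {}k.
    by move=> [x gx]; apply/mapP; exists (k, x).
  by move=> /mapP[[g x] gx ->]; exists x.
have [s' [s'M Ms']] : exists s' : seq T, (forall m, m \in s' -> M m) /\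
    forall m, M m -> gen [set` s'] m.
  apply: (schreier (s := map fst Y)) => //; last by move=> m /MH/HE.
  by apply: fin_index_restrict fM => k /HE.
have [l lP] := section_choice MK.
exists (map l s'); first by move=> _ /mapP[m /s'M Mm ->]; case: (lP m Mm).
exists u, M; split=> // m /Ms'.
apply: gen_min; first by apply: sections_at_subgroup; exact: gen_subgroup.
move=> {}m /= ms'; have [Km mu sm] := lP m (s'M m ms').
by exists (l m); split=> //; apply: gen_in; exact: map_f.
Qed.

(** An element with trivial section at which [lam] is nonzero would make the kernel
    large.  Without such elements, at the vertex [u] and one level below it,
    [lam] is a function of the section and induces a homomorphism on a normal
    finite-index subgroup of [H], to which [commute_of_homomorphism] applies. *)
Lemma large_cyclic K (lam : T -> int) : is_subgroup K -> additive_on K lam ->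
  large K -> large [set k | K k /\ lam k = 0%R] \/
  forall h k, H h -> H k -> commute_on Om h k.
Proof.
move=> sK lamM [u [M [sM MH fM MK]]]; have [K1 KM KV] := sK.
set N := [set k | K k /\ lam k = 0%R].
have sN : is_subgroup N.
  split=> [|k h [Kk k0] [Kh h0]|k [Kk k0]]; split=> //.
  - exact: additive1 lamM.
  - exact: KM.
  - by rewrite lamM // k0 h0.
  - exact: KV.
  - by rewrite (additiveV sK lamM) // k0.
have [//|nlarge] := pselect (large N); first by left.
right.
have descends v L : is_subgroup L -> (forall m, L m -> H m) -> finite_index_in L H ->
    (forall m, L m -> sections_at K v m) ->
    forall k, K k -> k v = v -> section k v = 1 -> lam k = 0%R.
  move=> sL LH fL LK k Kk kv k1; apply: contrapT => lamk; apply: nlarge.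
  apply: (large_section_sub sN sL LH fL (v := v)).
  exact: fin_index_kernel_sections lamk.
pose C := core H M; have sC : is_subgroup C by exact: core_subgroup.
have nC : normalized_by H C by exact: core_normalized.
have fC : finite_index_in C H by exact: fin_index_core.
have CM m : C m -> M m by case.
have CH m : C m -> H m by move=> /CM/MH.
have CK m : C m -> sections_at K u m by move=> /CM/MK.
have [l lP] := section_choice CK.
have lamE m k : C m -> K k -> k u = u -> section k u = m -> lam k = lam (l m).
  move=> Cm Kk ku sk; have [Kl lu sl] := lP m Cm.
  have [qu sq] := section_quot lu ku.
  have Klk : K ((l m)^-1 * k) by apply: KM => //; exact: KV.
  have : lam ((l m)^-1 * k) = 0%R.
    by apply: (descends u C) => //; rewrite sq sl sk mulVg.
  by rewrite lamM ?(additiveV sK lamM) //; [lia | exact: KV].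
apply: (@commute_of_homomorphism _ Y Ydir o Ytrans C (fun m => lam (l m))) => //.
- move=> m p Cm Cp; have [Km mu sm] := lP m Cm; have [Kp pu sp] := lP p Cp.
  rewrite -lamM //; symmetry; apply: lamE; [|exact: KM| |].
  + by case: sC => _ CMul _; exact: CMul.
  + by rewrite autM pu mu.
  + by rewrite section_fixM // sm sp.
- move=> m z Cm Oz mz m1; have [Kl lu sl] := lP m Cm.
  have sCz := sections_at_subgroup [:: z] sC.
  apply: (descends (u ++ [:: z]) (sections_at C [:: z])) => //.
  + by move=> _ [k [/CH Hk _ <-]]; exact: section_closed.
  + have HK h : H h -> sections_at [set k | H k /\ fixes_letters k] [:: z] h.
      have sT : is_subgroup [set: T] by [].
      have nT : normalized_by H [set: T] by [].
      move=> Hh; have [s [Hs _ fs sz]] :=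
        section_onto Ydir Ytrans Oz sT nT (fun _ _ _ => I) Hh.
      by exists s; split=> //; rewrite aut1letter fs.
    have := fin_index_sections sH (fin_index_restrict _ fC) HK.
    move=> /(_ (fun k Hk => Hk.1)); apply: fin_index_sub => h [_].
    exact: sections_at_sub.
  + move=> _ [k [Ck kz <-]]; have [Kk ku sk] := lP k Ck.
    exists (l k); rewrite section_cat_eq ku section_cat sk; split=> //.
    by rewrite kz.
  + by rewrite section_cat_eq lu sl aut1letter mz.
  + by rewrite section_cat sl.
- apply: contrapT => none; apply: nlarge; exists u, C; split=> // m Cm.
  have [Kl lu sl] := lP m Cm; exists (l m); split=> //; split=> //.
  by apply: contrapT => lm; apply: none; exists m.
Qed.

Lemma chou_commute : chou H -> forall h k, H h -> H k -> commute_on Om h k.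
Proof.
move=> CH; apply: contrapT => ncomm.
have notlarge K : chou K -> ~ large K.
  elim=> {K} [K K1 /large_nontrivial //|N K sN sK _ IHN fN lK
             |N K lam sN sK _ IHN lamM lamN lK|K sK _ IHK /large_local[s sK' ls]].
  - by apply: IHN; exact: large_finite fN lK.
  - have [lN|] := large_cyclic sK lamM lK; last exact: ncomm.
    by apply: IHN; apply: large_sub lN => k [Kk]; exact: lamN.
  - exact: IHK ls.
apply: (notlarge _ CH); exists [::], H; split=> //; first exact: fin_index_refl.
by move=> m Hm; exists m; rewrite aut_nil section_nil.
Qed.

Lemma section_word h w : H h -> H (section h w).
Proof.
elim: w h => [|x w IHw] h Hh; first by rewrite section_nil.
by rewrite -cat1s section_cat; apply: IHw; exact: section_closed.
Qed.

(** Commutators act trivially on the words over [Om], and the elements that do so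
    form a locally finite group. *)
Lemma transitive_virtually : chou H -> virtually_locfin_by_abelian H.
Proof.
move=> /chou_commute comm; exists H; split=> //; first exact: fin_index_refl.
pose N := [set k | H k /\ forall w, all Om w -> k w = w].
have sN : is_subgroup N.
  split=> [|k h [Hk kw] [Hh hw]|k [Hk kw]]; split=> //.
  - exact: gen_one.
  - exact: gen_mul.
  - by move=> w Ow; rewrite autM hw // kw.
  - exact: gen_inv.
  - by move=> w Ow; rewrite autV_fix // kw.
apply: (@locfin_sub _ N).
  apply: gen_min => // _ [a [b [Ha Hb ->]]]; have [_ HM HV] := sH.
  have Hba : H (b * a) by exact: HM.
  split; first by apply: (HM) => //; [exact: HV | apply: (HM); [exact: HV | exact: HM]].
  by move=> w Ow; rewrite commgEl conjgE !autM (comm a b Ha Hb w Ow) !autK.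
apply: (locfin_ker (Om := Om)) => [k w [_ kw] /kw //|k w x [Hk _] _ nOx].
rewrite -cats1 section_cat; apply: section_off_Om nOx => //; exact: section_word.
Qed.

End Large.

(** * Balanced generalized basilica groups *)

Section Assembly.
Variable X : finType.
Local Notation T := (tree_aut X).
Implicit Types (g h k : T) (x y z : X) (w : seq X).

Lemma trivial_virtually (K : set T) : is_subgroup K -> (forall k, K k -> k = 1) ->
  virtually_locfin_by_abelian K.
Proof.
move=> sK K1; exists K; split=> //; first exact: fin_index_refl.
apply: (@locfin_sub _ K) => [|s sK'].
  apply: gen_min => // _ [a [b [/K1 -> _ ->]]].
  by rewrite comm1g; case: sK.
have s1 k : gen [set` s] k -> k = 1.
  by move=> gk; apply: K1; exact: (gen_min sK sK') gk.
by exists unit, (fun=> tt) => g h /s1 -> /s1 -> _; rewrite /= mulVg.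
Qed.

(** Sections at [o] involve only the generators active on the orbit of [o].
    Passing to them reduces the generating set until a single orbit carries
    all active letters. *)
Lemma directed_virtually (Y : seq (T * X)) :
  (forall g x, (g, x) \in Y -> directed g x) ->
  chou (grp Y) -> virtually_locfin_by_abelian (grp Y).
Proof.
have [n] := ubnP (size Y); elim: n Y => // n IHn Y leY Ydir CY.
have [Y0|Ynil] := pselect (Y = [::]).
  apply: trivial_virtually; first exact: grp_subgroup.
  rewrite Y0; apply: (@gen_min _ _ [set 1]) => [|g [x] //].
  by split=> [//|x y -> ->|x ->] /=; rewrite ?mulg1 ?invg1.
have [[o /allP Yo]|ntrans] := pselect (exists o, all (fun p => orbit_of Y o p.2) Y).
  by apply: (@transitive_virtually _ Y Ydir o) => // g x /Yo.
apply: (@virtually_of_sections _ _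
  (fun x => grp [seq p <- Y | orbit_of Y x p.2])).
- exact: grp_subgroup.
- by move=> x k; exact: orbit_section.
move=> x; apply: IHn => [|g z|].
- rewrite ltnS in leY; apply: leq_trans leY; rewrite size_filter ltn_neqAle count_size andbT.
  by rewrite -all_count; apply/negP => Yx; apply: ntrans; exists x.
- by rewrite mem_filter => /andP[_]; exact: Ydir.
- apply: chou_sub CY; first exact: grp_subgroup.
  by apply: gen_mono => g [z]; rewrite mem_filter => /andP[_ gz]; exists z.
Qed.

Lemma least_fixing_order g x : least_fixing_power g x (period g x).
Proof.
split; first exact: period_gt0.
  by rewrite aut1letter root_permX iter_order //; exact: root_perm_inj.
move=> m m0; rewrite aut1letter root_permX => -[E]; rewrite leqNgt.
by apply/negP => /findex_iter; rewrite E findex0 => m0'; rewrite -m0' in m0.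
Qed.

(** The period is at least two: by balance, a generator fixing its active letter
    fixes all letters, hence by induction all words. *)
Lemma balanced_directed g x : g <> 1 -> g @ x = g ->
  (forall y, g @ y = 1 \/ g @ y = g) -> (forall y, g @ y = g -> x = y) ->
  (forall n, least_fixing_power g x n -> forall y, (g ^+ n) [:: y] = [:: y]) ->
  directed g x.
Proof.
move=> g1 gx gsec guniq gbal.
have period_fix y : iter (order (root_perm g) x) (root_perm g) y = y.
  have := gbal _ (least_fixing_order g x) y.
  by rewrite aut1letter root_permX => -[].
split=> // [y yx|].
  by case: (gsec y) => // /guniq xy; rewrite xy eqxx in yx.
apply/negP => /eqP gxx; apply: g1.
have ord1 : order (root_perm g) x = 1%N.
  case: (least_fixing_order g x) => _ _ /(_ 1%N isT).
  rewrite expg1 aut1letter gxx => /(_ erefl).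
  by have := period_gt0 g x; rewrite /period; lia.
have gfix y : root_perm g y = y by have := period_fix y; rewrite ord1.
apply: tree_aut_eq => w; elim: w => [|y w IHw]; first by rewrite aut_nil.
by rewrite aut_cons gfix; case: (gsec y) => ->; rewrite ?IHw.
Qed.

(** The remaining generators only permute the first level, so the sections of the
    group lie in the subgroup generated by the directed ones. *)
Lemma basilica_virtually (G : groupClosed T) : balanced_generalized_basilica G ->
  elementary_amenable (subgroup G) ->
  virtually_locfin_by_abelian [set k | k \in G].
Proof.
move=> [Y [[/finite_seqP[s Ys] GY Ybas] Ybal]] /elementary_amenable_chou CG.
pose Z := [seq p <- [seq (g, x) | g <- s, x <- enum X] | `[< directed p.1 p.2 >]].
have Zdir g x : (g, x) \in Z -> directed g x.
  by rewrite mem_filter => /andP[/asboolP].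
have YG g : Y g -> g \in G by move=> Yg; apply/GY/generatedP; exact: gen_in.
apply: (@virtually_of_sections _ _ (fun _ => grp Z)).
- exact: groupClosed_subgroup.
- move=> x k /= /GY /generatedP gk; elim: gk x => {k} [g Yg||g h _ IHg _ IHh|g _ IHg] x.
  + case: (Ybas g Yg) => [->|[gsec [z [gz guniq]]]]; first exact: gen_one.
    have [g1|g1] := pselect (g = 1); first by rewrite g1 section1; exact: gen_one.
    case: (gsec x) => ->; first exact: gen_one.
    apply: (@mem_grp _ _ _ z); rewrite mem_filter; apply/andP; split.
      by apply/asboolP; apply: balanced_directed => //; exact: Ybal.
    apply/allpairsP; exists (g, z); rewrite mem_enum; split=> //=.
    by move: Yg; rewrite Ys.
  + by rewrite section1; exact: gen_one.
  + by rewrite lsectionM; apply: gen_mul; [exact: IHg | exact: IHh].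
  + by rewrite -{1}(root_permKV g x) lsectionV; apply: gen_inv; exact: IHg.
- move=> _; apply: directed_virtually => //.
  apply: chou_sub CG; first exact: grp_subgroup.
  apply: gen_min; first exact: groupClosed_subgroup.
  move=> g [z]; rewrite mem_filter => /andP[_ /allpairsP[[g' x'] /= [gs _ [-> _]]]].
  by apply: YG; rewrite Ys.
Qed.

End Assembly.

Theorem theorem1p6 (X : finType) (hX : 2 <= #|X|)
    (G : groupClosed (tree_aut X)) (hG : balanced_generalized_basilica G) :
  group_by locally_finite virtually_abelian (subgroup G) \/
  ~ elementary_amenable (subgroup G).
Proof.
have [eaG|] := pselect (elementary_amenable (subgroup G)); last by right.
by left; apply: group_by_of_virtually; exact: basilica_virtually.
Qed.
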